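(* If $d=\dim_{\mathbb C}H^0_{(2)}(X,L)=\infty$, then with probability one the random holomorphic section $\psi^S_\eta=\sum_{j=1}^\infty\eta_jS_j$ is not $\mathcal L^2$-integrable on $X$.
   Context: $(X,J,\Theta)$ is a connected complex manifold without boundary of complex dimension $n$ with Hermitian form $\Theta$, $\mathrm{dV}=\Theta^n/n!$, and $(L,h_L)$ is a holomorphic line bundle on $X$ with smooth Hermitian metric. $H^0_{(2)}(X,L)$ is the separable Hilbert space of holomorphic sections $s$ of $L$ with $\int_X|s|^2_{h_L}\mathrm{dV}<\infty$, with inner product $\int_X\langle s_1,s_2\rangle_{h_L}\mathrm{dV}$. $S=\{S_j\}_{j=1}^d$ is an orthonormal basis of it and $\eta=\{\eta_j\}$ is a sequence of i.i.d. standard complex Gaussian random variables (law of $\frac1{\sqrt2}(A+\sqrt{-1}B)$ with $A,B$ independent standard real Gaussians). The series $\psi^S_\eta=\sum_j\eta_jS_j$ almost surely converges locally uniformly and defines a holomorphic section of $L$ on $X$. A section $\psi$ is $\mathcal L^2$-integrable if $\int_X|\psi|_{h_L}^2\mathrm{dV}<\infty$. *)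

(* Defs.v *)
From HB Require Import structures.
From mathcomp Require Import all_boot all_order all_algebra.
From mathcomp Require Import complex.
From mathcomp Require Import all_classical all_reals all_analysis.

Set Implicit Arguments.
Unset Strict Implicit.
Unset Printing Implicit Defensive.

Import Order.TTheory GRing.Theory Num.Theory.
Import numFieldTopology.Exports numFieldNormedType.Exports.

Local Open Scope classical_set_scope.
Local Open Scope ring_scope.

(* R[i] is the field of complex numbers over R; C^n is 'rV[R[i]]_n with its
   sup norm.  Derivatives taken in 'rV[R[i]]_n by the library ([differentiable],
   ['J]) are complex derivatives.  The instance gives R[i] the topology of its
   modulus. *)
HB.instance Definition _ (R : realType) :=
  PseudoMetricNormedZmod.copy R[i] R[i]^o.

Section functions_on_Cn.
Variable R : realType.
Implicit Types n k : nat.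

(* Holomorphic = complex Frechet differentiable at every point of an open set. *)
Definition holomorphic_Cn n (U : set 'rV[R[i]]_n) (f : 'rV[R[i]]_n -> R[i]) :=
  forall z, U z -> differentiable (f : 'rV[R[i]]_n -> R[i]^o) z.

(* Restriction of f to the real line z + t v, and its derivative at t = 0. *)
Definition real_line n (f : 'rV[R[i]]_n -> R) (z v : 'rV[R[i]]_n) (t : R) : R :=
  f (z + t%:C%C *: v).

Definition real_derive n (f : 'rV[R[i]]_n -> R) (v z : 'rV[R[i]]_n) : R :=
  derive1 (real_line f z v) 0.

(* Class C^k in the sense of real calculus on C^n = R^(2n): all iterated
   real directional derivatives of order at most k exist and are continuous. *)
Fixpoint Ck n k (U : set 'rV[R[i]]_n) (f : 'rV[R[i]]_n -> R) : Prop :=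
  (forall z, U z -> {for z, continuous f}) /\
  match k with
  | 0 => True
  | k'.+1 => forall v : 'rV[R[i]]_n,
      (forall z, U z -> derivable (real_line f z v) 0 1) /\
      Ck k' U (real_derive f v)
  end.

Definition smooth_Cn n (U : set 'rV[R[i]]_n) (f : 'rV[R[i]]_n -> R[i]) :=
  forall k, Ck k U (fun z => complex.Re (f z)) /\
            Ck k U (fun z => complex.Im (f z)).

(* Lebesgue integral over C^n = R^(2n) of a nonnegative Borel function, as an
   iterated integral (Tonelli). *)
Fixpoint integral_Cn n : ('rV[R[i]]_n -> \bar R) -> \bar R :=
  match n with
  | 0 => fun f => f 0
  | n'.+1 => fun f =>
      (\int[lebesgue_measure]_x \int[lebesgue_measure]_y
         integral_Cn (fun v : 'rV[R[i]]_n' =>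
           f (row_mx (const_mx (x +i* y)%C : 'rV[R[i]]_1) v)))%E
  end.

End functions_on_Cn.

Definition conjmx (R : realType) m n (A : 'M[R[i]]_(m, n)) : 'M[R[i]]_(m, n) :=
  map_mx (fun c : R[i] => c^*)%C A.

(* Complex manifold of dimension n, without boundary.  The functions
   [chart a] and [chart_inv a] are only meaningful on [chart_dom a] and
   [chart a @` chart_dom a].  The carrier is pointed because the library's
   measurable spaces are nonempty. *)
Record complex_manifold (R : realType) (n : nat) := ComplexManifold {
  carrier :> ptopologicalType ;
  manifold_hausdorff : hausdorff_space carrier ;
  manifold_second_countable : @second_countable carrier ;
  chart_index : Type ;
  chart_dom : chart_index -> set carrier ;
  chart : chart_index -> carrier -> 'rV[R[i]]_n ;
  chart_inv : chart_index -> 'rV[R[i]]_n -> carrier ;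
  chart_cover : forall x, exists a, chart_dom a x ;
  chart_dom_open : forall a, open (chart_dom a) ;
  chart_image_open : forall a, open (chart a @` chart_dom a) ;
  chartK : forall a x, chart_dom a x -> chart_inv a (chart a x) = x ;
  chart_continuous : forall a x, chart_dom a x ->
    {for x, continuous (chart a)} ;
  chart_inv_continuous : forall a z, (chart a @` chart_dom a) z ->
    {for z, continuous (chart_inv a)} ;
  chart_transition : forall a b z,
    (chart a @` (chart_dom a `&` chart_dom b)) z ->
    differentiable (chart b \o chart_inv a) z }.

Section functions_on_manifold.
Variables (R : realType) (n : nat) (X : complex_manifold R n).

Definition holomorphic_on (U : set X) (f : X -> R[i]) :=
  forall a : chart_index X,
    holomorphic_Cn (chart a @` (U `&` chart_dom a)) (f \o chart_inv a).

Definition smooth_on (U : set X) (f : X -> R[i]) :=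
  forall a : chart_index X,
    smooth_Cn (chart a @` (U `&` chart_dom a)) (f \o chart_inv a).

(* Borel sigma-algebra of X. *)
Definition borel := g_sigma_algebraType (@open X).

(* Positive (1,1)-form Theta, given in the chart a with coordinates z by
     Theta = sqrt(-1) * \sum_(j, k) (herm_coef a) j k dz_j /\ d(conj z_k).
   With ['J f z] j l = d f_l / d z_j, the last field is the transformation
   rule of such a form under the change of charts. *)
Record hermitian_form := HermitianForm {
  herm_coef : chart_index X -> X -> 'M[R[i]]_n ;
  herm_coef_hermitian : forall a x, chart_dom a x ->
    (conjmx (herm_coef a x))^T = herm_coef a x ;
  herm_coef_posdef : forall a x, chart_dom a x ->
    forall v : 'rV[R[i]]_n, v != 0 ->
      0 < (v *m herm_coef a x *m (conjmx v)^T) ord0 ord0 ;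
  herm_coef_smooth : forall a j k,
    smooth_on (chart_dom a) (fun x => herm_coef a x j k) ;
  herm_coef_transition : forall a b x, chart_dom a x -> chart_dom b x ->
    let J := jacobian (chart b \o chart_inv a) (chart a x) in
    herm_coef a x = J *m herm_coef b x *m (conjmx J)^T }.

(* Density of Theta^n/n! with respect to Lebesgue measure in a chart:
   Theta^n/n! = det(herm_coef) * \prod_j (sqrt(-1) dz_j /\ d(conj z_j)), and
   sqrt(-1) dz /\ d(conj z) = 2 dx /\ dy. *)
Definition volume_density (Theta : hermitian_form) a (x : X) : R :=
  2 ^+ n * complex.Re (\det (herm_coef Theta a x)).

(* mu is the Borel measure defined by the volume form dV = Theta^n/n!. *)
Definition is_volume_measure (Theta : hermitian_form)
    (mu : {measure set borel -> \bar R}) :=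
  forall (a : chart_index X) (A : set borel), measurable A ->
    A `<=` chart_dom a ->
    mu A = integral_Cn (fun z =>
      if z \in chart a @` A then (volume_density Theta a (chart_inv a z))%:E
      else 0%E).

(* Holomorphic line bundle: a family of complex vector spaces L_x together
   with local frames over an open cover (so that each L_x is a line) which are
   related by holomorphic transition functions. *)
Record line_bundle := LineBundle {
  fiber :> X -> lmodType R[i] ;
  frame_index : Type ;
  frame_dom : frame_index -> set X ;
  frame : frame_index -> forall x : X, fiber x ;
  frame_cover : forall x, exists a, frame_dom a x ;
  frame_dom_open : forall a, open (frame_dom a) ;
  frame_basis : forall a x, frame_dom a x ->
    forall v : fiber x, exists! c : R[i], v = c *: frame a x ;
  frame_transition : forall a b, exists2 g : X -> R[i],
    holomorphic_on (frame_dom a `&` frame_dom b) g &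
    forall x, frame_dom a x -> frame_dom b x ->
      frame b x = g x *: frame a x }.

Definition bundle_section (L : line_bundle) := forall x : X, L x.

Definition holomorphic_section (L : line_bundle) (s : bundle_section L) :=
  forall a : frame_index L, exists2 f : X -> R[i],
    holomorphic_on (frame_dom a) f &
    forall x, frame_dom a x -> s x = f x *: frame a x.

Record hermitian_metric (L : line_bundle) := HermitianMetric {
  hprod : forall x : X, L x -> L x -> R[i] ;
  hprod_linear : forall x (c : R[i]) (u v w : L x),
    hprod (c *: u + v) w = c * hprod u w + hprod v w ;
  hprod_conj : forall x (u v : L x), hprod v u = ((hprod u v)^*)%C ;
  hprod_posdef : forall x (v : L x), v != 0 -> 0 < hprod v v ;
  hprod_smooth : forall a : frame_index L,
    smooth_on (frame_dom a) (fun x => hprod (frame a x) (frame a x)) }.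

End functions_on_manifold.

Section square_integrable_sections.
Variables (R : realType) (n : nat) (X : complex_manifold R n).
Variables (mu : {measure set (borel X) -> \bar R}).
Variables (L : line_bundle X) (h : hermitian_metric L).

Definition hnorm (x : X) (v : L x) : R := Num.sqrt (complex.Re (hprod h v v)).

Definition sqnorm_L2 (s : bundle_section L) : \bar R :=
  (\int[mu]_(x in [set: borel X]) ((hnorm (s x)) ^+ 2)%:E)%E.

Definition L2_integrable (s : bundle_section L) := (sqnorm_L2 s < +oo)%E.

(* Membership in H^0_(2)(X, L). *)
Definition H02 (s : bundle_section L) :=
  holomorphic_section s /\ L2_integrable s.

Definition inner_L2 (s1 s2 : bundle_section L) : R[i] :=
  (Rintegral mu [set: borel X] (fun x => complex.Re (hprod h (s1 x) (s2 x)))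
   +i* Rintegral mu [set: borel X]
         (fun x => complex.Im (hprod h (s1 x) (s2 x))))%C.

Definition infinite_dimensional_H02 :=
  forall N : nat, exists2 s : 'I_N -> bundle_section L,
    forall i, H02 (s i) &
    forall c : 'I_N -> R[i],
      (forall x, \sum_(i < N) c i *: s i x = 0) -> forall i, c i = 0.

Definition combination (c : nat -> R[i]) (S : nat -> bundle_section L)
    (N : nat) : bundle_section L :=
  fun x => \sum_(j < N) c j *: S j x.

(* (S_j)_(j in N) is an orthonormal basis of H^0_(2)(X, L): it is orthonormal
   and every element is the L^2-sum of its Fourier series. *)
Definition orthonormal_basis_H02 (S : nat -> bundle_section L) :=
  [/\ forall j, H02 (S j),
      forall j k, inner_L2 (S j) (S k) = (j == k)%:R &
      forall s, H02 s ->
        (fun N => sqnorm_L2 (fun x =>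
           s x - combination (fun j => inner_L2 s (S j)) S N x))
          @ \oo --> 0%E].

(* Locally uniform convergence, measured with the metric of L. *)
Definition cvg_locally_uniformly (s_ : nat -> bundle_section L)
    (s : bundle_section L) :=
  forall x : X, exists2 U : set X, nbhs x U &
    forall e : R, 0 < e ->
      \forall N \near \oo, forall y, U y -> hnorm (s_ N y - s y) < e.

(* psi is (a version of) the random section \sum_j eta_j S_j. *)
Definition random_section_of d (Omega : measurableType d)
    (P : probability Omega R) (eta : nat -> Omega -> R[i])
    (S : nat -> bundle_section L) (psi : Omega -> bundle_section L) :=
  {ae P, forall w,
    cvg_locally_uniformly (combination (fun j => eta j w) S) (psi w)}.

End square_integrable_sections.

Section gaussian.
Variables (R : realType) (d : measure_display) (Omega : measurableType d).
Variable P : probability Omega R.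

(* Complex random variables are handled through the identification of R[i]
   with R * R. *)
Definition complex_pair (Z : Omega -> R[i]) (w : Omega) : R * R :=
  (complex.Re (Z w), complex.Im (Z w)).

(* Law of (A + sqrt(-1) B) / sqrt 2 with A, B independent N(0, 1). *)
Definition std_complex_gaussian (Z : Omega -> R[i]) :=
  measurable_fun [set: Omega] (complex_pair Z) /\
  forall E : set (R * R), measurable E ->
    P (complex_pair Z @^-1` E) =
    (normal_prob (0 : R) 1 \x normal_prob (0 : R) 1)%E
      [set ab | E (ab.1 / Num.sqrt 2, ab.2 / Num.sqrt 2)].

Definition mutually_independent (Z : nat -> Omega -> R[i]) :=
  forall (J : seq nat) (E : nat -> set (R * R)), uniq J ->
    (forall j, measurable (E j)) ->
    P (\bigcap_(j in [set` J]) (complex_pair (Z j) @^-1` E j)) =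
    (\prod_(j <- J) P (complex_pair (Z j) @^-1` E j))%E.

Definition iid_std_complex_gaussian (Z : nat -> Omega -> R[i]) :=
  (forall j, std_complex_gaussian (Z j)) /\ mutually_independent Z.

End gaussian.

(* Main.v *)
Require Import Defs.
From HB Require Import structures.
From mathcomp Require Import all_boot all_order all_algebra.
From mathcomp Require Import complex.
From mathcomp Require Import all_classical all_reals all_analysis.
From mathcomp Require Import measurable_realfun.
From mathcomp Require Import ring lra.

Set Implicit Arguments.
Unset Strict Implicit.
Unset Printing Implicit Defensive.

Import Order.TTheory GRing.Theory Num.Theory.
Import numFieldTopology.Exports numFieldNormedType.Exports.

Local Open Scope classical_set_scope.
Local Open Scope ring_scope.

(** Bessel's inequality gives [\sum_k |<psi, S_k>|^2 <= |psi|^2] as soon as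
    [psi] is square integrable.  The difficulty is that convergence of
    [\sum_j eta_j S_j] to [psi] is only locally uniform, which does not by itself
    identify the coefficient [<psi, S_k>] with [eta_k].  Independence of the
    [eta_j] replaces this identification.

    Only real parts are used: [b_k = Re <psi, S_k>].  For suitable sets [K m k],
    on which convergence is uniform and which exhaust, as [m] grows, the set where
    [S_k] does not vanish, [b_k] is the limit over [m] of the limit over [N] of
    [Re (\sum_(j < N) eta_j <S_j, S_k>_(K m k))] ([L2_limit_data]).  For fixed
    [n] and [k < n], the terms [j < n] tend to [Re eta_k] as [m] grows, by
    orthonormality and dominated convergence.  Hence, for [k < n],
    [b_k = Re eta_k + r_k] where the [r_k] are iterated limits of variables
    depending only on the [eta_j] with [j >= n], thus independent of
    [eta_0, ..., eta_(n-1)].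

    There is a constant [rho < 1] such that
    [E exp (- (Re eta_k + y)^2) <= rho] for every real [y]
    ([re_gaussian_damping]).  Integrating the independent variables one after the
    other, [E exp (- \sum_(k < n) (Re eta_k + r_k)^2) <= rho^n] when the [r_k]
    depend on the tail only ([damping_prod]); Fatou's lemma, applied twice, passes
    the bound to the iterated limit inferior.  By Markov's inequality the event
    that [\sum_(k < n) b_k^2 <= M] for all [n] is then null for every [M]
    ([gaussian_translates_null]), and by Bessel's inequality this covers the
    event that [psi] is square integrable. *)


(** * Independence of a variable from the tail of the sequence *)

(** Independence from a pi-system extends to the sigma-algebra that it generates.
    Measurability is part of the conclusion because the proof is a single
    Dynkin-class argument. *)
Lemma indep_g_sigma (R : realType) (d : measure_display)
  (Omega : measurableType d) (P : probability Omega R) (A : set Omega)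
  (G : set (set Omega)) : measurable A -> setI_closed G ->
  G `<=` measurable ->
  (forall B, G B -> P (A `&` B) = (P A * P B)%E) ->
  forall B, <<s G >> B -> measurable B /\ P (A `&` B) = (P A * P B)%E.
Proof.
move=> mA GI Gm GP; rewrite -setI_closed_g_dynkin_g_sigma_algebra//.
suff dD : dynkin [set B | measurable B /\ P (A `&` B) = (P A * P B)%E].
  by apply: smallest_sub => // B GB; split; [exact: Gm|exact: GP].
split.
- by split; [exact: measurableT|rewrite setIT probability_setT mule1].
- move=> B [mB PB]; split; first exact: measurableC.
  rewrite probability_setC// -setDE measureD ?PB//; last first.
    by rewrite ltey_eq fin_num_measure.
  rewrite muleBr ?mule1 ?fin_num_measure//.
  exact: (congr1 (fun t => P A - t)%E PB).
- move=> F tF FD; have mF k : measurable (F k) by have [] := FD k.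
  split; first exact: bigcup_measurable.
  rewrite setI_bigcupr measure_bigcup//; first last.
  + by apply: trivIset_setIl.
  + by move=> i _; exact: measurableI.
  rewrite measure_bigcup// -[X in (X * _)%E](fineK (fin_num_measure P A mA)).
  rewrite -nneseriesZl//; apply: eq_eseriesr => i _; rewrite fineK.
    by have [] := FD i.
  exact: fin_num_measure.
Qed.

Section tail.
Context (R : realType) (d : measure_display) (Omega : measurableType d).
Variables (P : probability Omega R) (Z : nat -> Omega -> R[i]).

(** Events which constrain finitely many of the variables [Z j], [k <= j].  The
    index list [J] may be empty, so the whole space is a cylinder. *)
Definition tail_cylinders (k : nat) : set (set Omega) :=
  [set B | exists J (E : nat -> set (R * R)), [/\ uniq J, all (leq k) J,
    (forall j, measurable (E j)) &
    B = \bigcap_(j in [set` J]) (complex_pair (Z j) @^-1` E j)]].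

(** [Omega] with the sigma-algebra generated by the [Z j], [k <= j].  A function
    depends on the tail only when it is measurable as a function on [tail k]. *)
Definition tail (k : nat) := g_sigma_algebraType (tail_cylinders k).

Lemma tail_cylindersI k : setI_closed (tail_cylinders k).
Proof.
move=> _ _ [J1 [E1 [uJ1 kJ1 mE1 ->]]] [J2 [E2 [uJ2 kJ2 mE2 ->]]].
exists (undup (J1 ++ J2)), (fun j => (if j \in J1 then E1 j else setT) `&`
   (if j \in J2 then E2 j else setT)); split.
- exact: undup_uniq.
- apply/allP => j; rewrite mem_undup mem_cat => /orP[].
  + exact: (allP kJ1).
  + exact: (allP kJ2).
- by move=> j; apply: measurableI; case: ifP.
- apply/seteqP; split => w /=.
  + by move=> [w1 w2] j /=; split; case: ifPn => // jJ; [exact: w1|exact: w2].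
  + move=> H; split => j /= jJ; have := H j;
      by rewrite /= mem_undup mem_cat jJ ?orbT => /(_ isT)[].
Qed.

Hypothesis mZ : forall j, measurable_fun setT (complex_pair (Z j)).

Lemma measurable_tail_cylinders k : tail_cylinders k `<=` measurable.
Proof.
move=> _ [J [E [_ _ mE ->]]]; apply: bigcap_measurableType.
move=> j _; rewrite -[X in measurable X]setTI; exact: mZ.
Qed.

Lemma measurable_tail_id k : measurable_fun setT (id : Omega -> tail k).
Proof.
move=> _ B mB; rewrite setTI preimage_id.
suff : <<s tail_cylinders k >> `<=` measurable by exact.
by apply: smallest_sub; [exact: sigma_algebra_measurable|
  exact: measurable_tail_cylinders].
Qed.

Lemma measurable_tail k j : (k <= j)%N ->
  measurable_fun setT (complex_pair (Z j) : tail k -> R * R).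
Proof.
move=> kj _ E mE; rewrite setTI; apply: sub_sigma_algebra.
exists [:: j], (fun=> E); split => //=; first by rewrite kj.
by rewrite set_cons1 bigcap_set1.
Qed.

Lemma measurable_tail_le k l : (k <= l)%N ->
  measurable_fun setT (id : tail k -> tail l).
Proof.
move=> kl _ B mB; rewrite setTI preimage_id; move: B mB.
apply: sub_sigma_algebra2 => _ [J [E [uJ lJ mE ->]]].
exists J, E; split => //; apply: sub_all lJ => j; exact: leq_trans.
Qed.

Hypothesis indepZ : mutually_independent P Z.

Lemma tail_indep k E (B : set Omega) : measurable E ->
  (measurable : set (set (tail k.+1))) B ->
  P (complex_pair (Z k) @^-1` E `&` B) = (P (complex_pair (Z k) @^-1` E) * P B)%E.
Proof.
move=> mE mB; have mA : measurable (complex_pair (Z k) @^-1` E).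
  by rewrite -[X in measurable X]setTI; exact: mZ.
apply: (proj2 (@indep_g_sigma _ _ _ P _ (tail_cylinders k.+1) mA _ _ _ B mB)).
- exact: tail_cylindersI.
- exact: measurable_tail_cylinders.
move=> _ [J [F [uJ kJ mF ->]]].
have kNJ : k \notin J.
  by apply/negP => /(allP kJ); rewrite ltnn.
have kE j : j \in J -> (j == k) = false.
  by move=> jJ; apply/negP => /eqP jk; move: kNJ; rewrite -jk jJ.
rewrite indepZ//.
pose E' j := if j == k then E else F j.
have /(_ _)/= := @indepZ (k :: J) E' _ _; rewrite kNJ uJ => /(_ isT).
rewrite big_cons /E' eqxx => Hk; transitivity
  (P (\bigcap_(j in [set` k :: J]) (complex_pair (Z j) @^-1` E' j))).
  congr (P _); apply/seteqP; split => w /=.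
  - move=> [wE wF] j /=; rewrite inE /E'; have [->//|_] := eqVneq j k.
    exact: wF.
  - move=> H; split; first by have := H k; rewrite /= mem_head /E' eqxx; exact.
    move=> j /= jJ; have := H j; rewrite /= inE jJ orbT /E' kE//; exact.
rewrite Hk; last by move=> j; case: ifP.
by congr (_ * _)%E; apply: eq_big_seq => j jJ; rewrite kE.
Qed.

End tail.

(** * A Gaussian damping factor smaller than one *)

Local Notation std_normal := (normal_prob 0 1).

(** The density is bounded below on a bounded interval. *)
Lemma std_normal_itv_gt0 (R : realType) (a : R) :
  (0 < (std_normal `[a, (a + 1)%R] : \bar R))%E.
Proof.
pose m : R := normal_peak (1 : R) * expR (- (`|a| + 1) ^+ 2 / 2).
have m0 : 0 < m by rewrite mulr_gt0 ?normal_peak_gt0 ?oner_eq0 ?expR_gt0.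
apply: (@lt_le_trans _ _ (\int[lebesgue_measure]_(x in `[a, (a + 1)%R]) m%:E)%E).
  rewrite integral_cst//=; rewrite lebesgue_measure_itv/= lte_fin ltrDl ltr01.
  by rewrite -EFinB -EFinM lte_fin mulr_gt0// subr_gt0 ltrDl ltr01.
apply: ge0_le_integral => //=.
- by move=> x _; rewrite lee_fin ltW.
- apply/measurable_funTS/measurable_EFinP.
  exact: measurable_normal_pdf.
move=> x /= xa; rewrite lee_fin normal_pdfE ?oner_eq0// ler_pM2l; last first.
  by rewrite normal_peak_gt0 ?oner_eq0.
rewrite ler_expR subr0 expr1n !mulNr lerN2 ler_pM2r ?invr_gt0//.
rewrite -[x ^+ 2]real_normK ?num_real// lerXn2r ?nnegrE ?addr_ge0//.
move: xa; rewrite in_itv/= => /andP[ax xa1].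
rewrite ler_norml; have := ler_norm a; have := ler_norm (- a); rewrite normrN.
by lra.
Qed.

Lemma measurable_gauss_comp (R : realType) (d : measure_display)
  (T : measurableType d) (f : T -> R) : measurable_fun setT f ->
  measurable_fun setT (fun w => expR (- f w ^+ 2)).
Proof.
move=> mf; apply: measurableT_comp => //; apply: measurableT_comp => //.
exact: measurable_funX.
Qed.

Section re_gaussian.
Context (R : realType) (d : measure_display) (Omega : measurableType d).
Variable P : probability Omega R.

(** Real part of a complex random variable. *)
Definition re_part (Z : Omega -> R[i]) (w : Omega) : R := complex.Re (Z w).

Lemma measurable_re_part (Z : Omega -> R[i]) :
  measurable_fun setT (complex_pair Z) -> measurable_fun setT (re_part Z).
Proof. by move=> mZ; apply: (measurableT_comp measurable_fst mZ). Qed.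

(** The real part of a standard complex Gaussian is a centered normal variable of
    variance 1/2. *)
Lemma re_gaussian_law (Z : Omega -> R[i]) (E : set R) :
  std_complex_gaussian P Z -> measurable E ->
  P (re_part Z @^-1` E) = std_normal [set a | E (a / Num.sqrt 2)].
Proof.
move=> [mZ PZ] mE.
have -> : re_part Z @^-1` E = complex_pair Z @^-1` (E `*` setT).
  by apply/seteqP; split => w //= [].
rewrite PZ; last exact: measurableX.
rewrite (_ : mkset _ = [set a | E (a / Num.sqrt 2)] `*` setT); last first.
  by apply/seteqP; split => -[a b] //= [].
rewrite product_measure1E//=; last first.
  have : measurable_fun setT (fun a : R => a / Num.sqrt 2).
    exact: measurable_funM.
  by move=> /(_ measurableT E mE); rewrite setTI.
by rewrite -/(std_normal _) probability_setT mule1.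
Qed.

(** The constant is uniform in the translation [y].  One of the half-lines
    [x >= 1], [x <= -1] lies at distance at least 1 from [- y]; there the
    integrand is at most [expR (- 1)], and elsewhere at most 1.  Both half-lines
    have positive probability. *)
Lemma re_gaussian_damping : exists2 rho : R, 0 <= rho < 1 &
  forall Z, std_complex_gaussian P Z -> forall y : R,
    (\int[P]_w (expR (- (re_part Z w + y) ^+ 2))%:E <= rho%:E)%E.
Proof.
pose s := Num.sqrt (2 : R).
have s0 : 0 < s by rewrite sqrtr_gt0.
pose p1 := fine (std_normal `[s, s + 1] : \bar R).
pose p2 := fine (std_normal `[- s - 1, - s - 1 + 1] : \bar R).
have fp a : (std_normal `[a, a + 1] : \bar R) \is a fin_num.
  exact: fin_num_measure.
have p10 : 0 < p1 by rewrite fine_gt0// std_normal_itv_gt0 /= ltey_eq fp.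
have p20 : 0 < p2 by rewrite fine_gt0// std_normal_itv_gt0 /= ltey_eq fp.
pose p := Num.min p1 p2.
have p0 : 0 < p by rewrite lt_min p10.
have p11 : p1 <= 1.
  by rewrite -lee_fin fineK ?fp// probability_le1.
have p1' : p <= 1 by rewrite ge_min p11.
pose c := 1 - expR (- (1 : R)).
have c0 : 0 < c by rewrite subr_gt0 expR_lt1 oppr_lt0 ltr01.
have c1 : c <= 1 by rewrite gerBl expR_ge0.
exists (1 - c * p).
  rewrite gtrBl mulr_gt0// andbT subr_ge0.
  by rewrite mulr_ile1// ltW.
move=> Z GZ y; have mre := measurable_re_part (proj1 GZ).
have mf : measurable_fun setT (fun w => expR (- (re_part Z w + y) ^+ 2)).
  by apply: measurable_gauss_comp; exact: measurable_funD.
pose B : set R := if 0 <= y then `[1, +oo[%classic else `]-oo, -1]%classic.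
have mB : measurable B by rewrite /B; case: ifP.
have mA : measurable (re_part Z @^-1` B).
  by rewrite -[X in measurable X]setTI; exact: mre.
have pB : (p%:E <= P (re_part Z @^-1` B))%E.
  rewrite re_gaussian_law//.
  have mB' : measurable [set a : R | B (a / s)].
    have : measurable_fun setT (fun a : R => a / s) by exact: measurable_funM.
    by move=> /(_ measurableT B mB); rewrite setTI.
  have [y0|y0] := leP 0 y.
  - apply: (@le_trans _ _ p1%:E); first by rewrite lee_fin ge_min lexx.
    rewrite fineK ?fp//; apply: le_measure; rewrite ?inE//.
    move=> a /=; rewrite in_itv/= /B y0 /= in_itv/= andbT => /andP[sa _].
    by rewrite ler_pdivlMr// mul1r.
  - apply: (@le_trans _ _ p2%:E); first by rewrite lee_fin ge_min lexx orbT.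
    rewrite fineK ?fp//; apply: le_measure; rewrite ?inE//.
    move=> a /=; rewrite in_itv/= /B (lt_geF y0) /= in_itv/= => /andP[_ sa].
    by rewrite ler_pdivrMr// mulN1r; move: sa; rewrite subrK.
have bnd : (\int[P]_w (expR (- (re_part Z w + y) ^+ 2))%:E +
    c%:E * P (re_part Z @^-1` B) <= 1)%E.
  rewrite -(setIT (re_part Z @^-1` B)) -integral_indic// -ge0_integralZl//=; last 2 first.
  - exact/measurable_EFinP.
  - by rewrite lee_fin ltW.
  rewrite -ge0_integralD//=; last 3 first.
  - exact/measurable_EFinP.
  - by move=> w _; rewrite -EFinM lee_fin mulr_ge0// ltW.
  - apply/measurable_EFinP; exact: measurable_funM.
  rewrite -[leRHS](@probability_setT _ _ _ P) -[leRHS]mul1e -integral_cst//.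
  apply: ge0_le_integral => //=.
  - by move=> w _; rewrite -EFinM -EFinD lee_fin addr_ge0 ?expR_ge0// mulr_ge0// ltW.
  - apply/measurable_EFinP; apply: measurable_funD => //.
    exact: measurable_funM.
  move=> w _; rewrite -EFinM -EFinD lee_fin indicE.
  have [/set_mem wB|_] := boolP (w \in _); last first.
    by rewrite mulr0 addr0 -expR0 ler_expR oppr_le0 sqr_ge0.
  rewrite mulr1 /c addrCA gerDl subr_le0 ler_expR lerN2.
  move: wB => /=; rewrite /B; have [y0|y0] := leP 0 y.
  + rewrite /= in_itv/= andbT => x1; apply: exprn_ege1; lra.
  + by rewrite /= in_itv/= => x1; nra.
move: bnd; have : P (re_part Z @^-1` B) \is a fin_num by exact: fin_num_measure.
move=> /fineK H; rewrite -H -EFinM => bnd.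
rewrite EFinB leeBrDr//; apply: le_trans bnd.
rewrite leeD2l// lee_fin ler_pM2l//.
by rewrite -lee_fin H.
Qed.

End re_gaussian.

(** * Products of damping factors *)

Section damping.
Context (R : realType) (d : measure_display) (Omega : measurableType d).
Variables (P : probability Omega R) (Z : nat -> Omega -> R[i]).
Hypothesis iidZ : iid_std_complex_gaussian P Z.

Let mZ j : measurable_fun setT (complex_pair (Z j)) := proj1 (proj1 iidZ j).

(** The random factor [exp (- (Re (Z k) + r)^2)]. *)
Definition damping (k : nat) (r : Omega -> R) (w : Omega) : R :=
  expR (- (re_part (Z k) w + r w) ^+ 2).

(** The joint law of [Re (Z k)] and of the tail after [k] is a product measure, so
    the variable [Z k] may be integrated out with the tail frozen.  The
    measurability of the inner integral is with respect to [Omega]. *)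
Lemma re_part_tail_fubini k (f : R * tail Z k.+1 -> \bar R) :
  measurable_fun setT f -> (forall x, (0 <= f x)%E) ->
  measurable_fun [set: Omega] (fun w => \int[P]_v f (re_part (Z k) v, w))%E /\
  (\int[P]_w f (re_part (Z k) w, w) =
   \int[P]_w \int[P]_v f (re_part (Z k) v, w))%E.
Proof.
move=> mf f0; have mX := measurable_re_part (mZ k).
have mI : measurable_fun setT (id : Omega -> tail Z k.+1).
  exact: measurable_tail_id.
have mJ : measurable_fun setT
    ((fun w => (re_part (Z k) w, w)) : Omega -> R * tail Z k.+1).
  exact: measurable_fun_pair.
pose X : {mfun Omega >-> R} :=
  HB.pack (re_part (Z k)) (isMeasurableFun.Build _ _ _ _ _ mX).
pose I : {mfun Omega >-> tail Z k.+1} :=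
  HB.pack (id : Omega -> tail Z k.+1) (isMeasurableFun.Build _ _ _ _ _ mI).
pose J : {mfun Omega >-> (R * tail Z k.+1)%type} :=
  HB.pack ((fun w => (re_part (Z k) w, w)) : Omega -> R * tail Z k.+1)
    (isMeasurableFun.Build _ _ _ _ _ mJ).
have jointE (A : set (R * tail Z k.+1)) : measurable A ->
    (distribution P X \x distribution P I)%E A = distribution P J A.
  apply: product_measure_unique => {}A B mA mB.
  change (P ((fun w => (re_part (Z k) w, w)) @^-1` (A `*` B)) =
    (P (re_part (Z k) @^-1` A) * P B)%E).
  have -> : re_part (Z k) @^-1` A = complex_pair (Z k) @^-1` (A `*` setT).
    by apply/seteqP; split => w //= [].
  have -> : (fun w => (re_part (Z k) w, w)) @^-1` (A `*` B) =
      complex_pair (Z k) @^-1` (A `*` setT) `&` B.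
    by apply/seteqP; split => w //= [] // [].
  apply: tail_indep => //; first by have [] := iidZ.
  exact: measurableX.
have GE : fubini_G (distribution P X) f =
    (fun w => \int[P]_v f (re_part (Z k) v, w))%E.
  apply/funext => w; rewrite /fubini_G ge0_integral_pushforward//.
  by apply: measurableT_comp => //; exact: measurable_pair2.
have mG : measurable_fun setT (fubini_G (distribution P X) f).
  exact: measurable_fun_fubini_tonelli_G.
split; first by rewrite -GE; exact: (measurableT_comp mG mI).
transitivity (\int[distribution P J]_x f x)%E.
  by rewrite ge0_integral_pushforward.
rewrite (eq_measure_integral (distribution P X \x distribution P I)%E); last first.
  by move=> A mA _; apply/esym/jointE.
rewrite fubini_tonelli2//.
rewrite ge0_integral_pushforward//; last first.
  by move=> y _; exact: integral_ge0.
by rewrite GE.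
Qed.

Lemma damping_step rho k (r W : Omega -> R) : 0 <= rho ->
  (forall Z, std_complex_gaussian P Z -> forall y : R,
    (\int[P]_w (expR (- (re_part Z w + y) ^+ 2))%:E <= rho%:E)%E) ->
  measurable_fun setT (r : tail Z k.+1 -> R) ->
  measurable_fun setT (W : tail Z k.+1 -> R) ->
  (forall w, 0 <= W w) ->
  (\int[P]_w (damping k r w * W w)%:E <= rho%:E * \int[P]_w (W w)%:E)%E.
Proof.
move=> rho0 Hrho mr mW W0.
have mX := measurable_re_part (mZ k).
have mI : measurable_fun setT (id : Omega -> tail Z k.+1).
  exact: measurable_tail_id.
pose f (x : R * tail Z k.+1) : \bar R :=
  (expR (- (x.1 + r x.2) ^+ 2) * W x.2)%:E.
have mf : measurable_fun setT f.
  apply/measurable_EFinP; apply: measurable_funM; last exact: measurableT_comp.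
  by apply/measurable_gauss_comp/measurable_funD => //; exact: measurableT_comp.
have f0 x : (0 <= f x)%E by rewrite lee_fin mulr_ge0 ?expR_ge0.
have [mG ->] := re_part_tail_fubini mf f0.
have mWO : measurable_fun setT W by exact: (measurableT_comp mW mI).
rewrite -ge0_integralZl//=; last 2 first.
- exact/measurable_EFinP.
- by move=> w _; rewrite lee_fin.
apply: ge0_le_integral => //.
- by move=> w _; exact: integral_ge0.
- by apply: emeasurable_funM => //; exact/measurable_EFinP.
move=> w _; rewrite /f /=.
under eq_integral do rewrite mulrC EFinM.
rewrite ge0_integralZl//=; last 2 first.
- by apply/measurable_EFinP/measurable_gauss_comp; exact: measurable_funD.
- by rewrite lee_fin.
by rewrite muleC lee_wpmul2r ?lee_fin// Hrho//; have [] := iidZ.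
Qed.

(** The translations [r k] depend on the variables of index at least [n] only.  The
    factors are integrated out in the order [k = 0, 1, ..., n - 1]: when the
    factor [k] is removed, the following ones depend on the tail after [k]. *)
Lemma damping_prod rho n (r : nat -> Omega -> R) : 0 <= rho ->
  (forall Z, std_complex_gaussian P Z -> forall y : R,
    (\int[P]_w (expR (- (re_part Z w + y) ^+ 2))%:E <= rho%:E)%E) ->
  (forall k, measurable_fun setT (r k : tail Z n -> R)) ->
  (\int[P]_w (\prod_(k < n) damping k (r k) w)%:E <= (rho ^+ n)%:E)%E.
Proof.
move=> rho0 Hrho mr.
suff H i : (i <= n)%N ->
    (\int[P]_w (\prod_(n - i <= k < n) damping k (r k) w)%:E
      <= (rho ^+ i)%:E)%E.
  have := H n (leqnn n); rewrite subnn.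
  by under eq_integral do rewrite big_mkord.
elim: i => [|i IH] lin.
  rewrite expr0 subn0; under eq_integral do rewrite big_geq//.
  by rewrite integral_cst// mul1e; exact: probability_le1.
have nk : (n - i.+1 < n)%N by rewrite ltn_subrL (leq_trans _ lin).
under eq_integral do rewrite big_ltn//.
rewrite subnSK//; apply: le_trans.
  apply: (damping_step rho0 Hrho).
  - exact: (measurableT_comp (mr _) (measurable_tail_le nk)).
  - apply: measurable_prod => k; rewrite mem_index_iota => /andP[ik kn].
    apply: measurable_gauss_comp.
    apply: measurable_funD.
      have ik' : ((n - i.+1).+1 <= k)%N by rewrite subnSK.
      exact: (measurableT_comp measurable_fst (@measurable_tail _ _ _ Z _ _ ik')).
    exact: (measurableT_comp (mr _) (measurable_tail_le nk)).
  - by move=> w; apply: prodr_ge0 => k _; exact: expR_ge0.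
rewrite exprS EFinM lee_wpmul2l ?lee_fin//; apply: IH; exact: ltnW.
Qed.

End damping.

(** * A null set for translated Gaussian sequences *)

Section liminf_bound.
Context (R : realType) (d : measure_display) (T : measurableType d).
Variable P : {measure set T -> \bar R}.

Lemma limn_einf_le (u : (\bar R)^nat) c :
  (forall n, (u n <= c)%E) -> (limn_einf u <= c)%E.
Proof.
move=> uc; rewrite limn_einf_lim; apply: lime_le; first exact: is_cvg_einfs.
apply: nearW => n; apply: le_trans (uc n).
by apply: ereal_inf_lbound; exists n => /=.
Qed.

Lemma limn_einf_ge0 (u : (\bar R)^nat) :
  (forall n, (0 <= u n)%E) -> (0 <= limn_einf u)%E.
Proof.
move=> u0; rewrite limn_einf_lim; apply: lime_ge; first exact: is_cvg_einfs.
by apply: nearW => n; apply: le_ereal_inf_tmp => _ [m _ <-].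
Qed.

Lemma measurable_limn_einf (F : (T -> \bar R)^nat) :
  (forall n, measurable_fun setT (F n)) ->
  measurable_fun setT (fun w => limn_einf (F ^~ w)).
Proof.
move=> mF; apply: (emeasurable_fun_cvg (fun n w => einfs (F ^~ w) n)).
  by move=> n; exact: measurable_fun_einfs.
by move=> w _; rewrite limn_einf_lim; exact: is_cvg_einfs.
Qed.

Lemma integral_limn_einf_le (F : (T -> \bar R)^nat) c :
  (forall n, measurable_fun setT (F n)) -> (forall n w, (0 <= F n w)%E) ->
  (forall n, (\int[P]_w F n w <= c)%E) ->
  (\int[P]_w limn_einf (F ^~ w) <= c)%E.
Proof.
move=> mF F0 Fc; apply: le_trans (fatou _ _ _ _) _ => //.
exact: limn_einf_le.
Qed.

End liminf_bound.

Lemma cvg_gauss_prod (R : realType) n (u : nat -> nat -> R) (v : nat -> R) :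
  (forall k, (k < n)%N -> u k i @[i --> \oo] --> v k) ->
  \prod_(k < n) expR (- u k i ^+ 2) @[i --> \oo] -->
    \prod_(k < n) expR (- v k ^+ 2).
Proof.
move=> uv; apply: cvg_big => [|k _]; first exact: mul_continuous.
apply: (cvg_comp _ expR); last exact: continuous_expR.
by apply: cvgN; rewrite expr2; under eq_fun do rewrite expr2; apply: cvgM; exact: uv.
Qed.

Section null.
Context (R : realType) (d : measure_display) (Omega : measurableType d).
Variables (P : probability Omega R) (Z : nat -> Omega -> R[i]).
Hypothesis iidZ : iid_std_complex_gaussian P Z.

Let mZ j : measurable_fun setT (complex_pair (Z j)) := proj1 (proj1 iidZ j).

(** The translations [r n m N k] are indexed by the number [n] of coordinates under
    consideration, two limit parameters [m] and [N], and the coordinate [k].  On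
    [B], the coordinates [b k] are iterated limits of [Re (Z k) + r n m N k], and
    their squares have bounded partial sums; the bound depends on the point, but
    not on [n].  No measurability of [B] is needed. *)
Lemma gaussian_translates_null (r : nat -> nat -> nat -> nat -> Omega -> R)
  (B : set Omega) :
  (forall n m N k, measurable_fun setT (r n m N k : tail Z n -> R)) ->
  (forall w, B w -> exists M : R, forall n, exists (b : nat -> R)
      (c : nat -> nat -> R), [/\ \sum_(k < n) b k ^+ 2 <= M,
      forall k, (k < n)%N -> c ^~ k @ \oo --> b k &
      forall m k, (k < n)%N ->
        re_part (Z k) w + r n m N k w @[N --> \oo] --> c m k]) ->
  P.-negligible B.
Proof.
move=> mr HB.
have [rho /andP[rho0 rho1] Hrho] := re_gaussian_damping P.
have mro n m N k : measurable_fun setT (r n m N k).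
  exact: (measurableT_comp (mr n m N k) (measurable_tail_id mZ (k:=n))).
pose F n m N w : \bar R := (\prod_(k < n) damping Z k (r n m N k) w)%:E.
have mF n m N : measurable_fun setT (F n m N).
  apply/measurable_EFinP; apply: measurable_prod => k _.
  apply: measurable_gauss_comp; apply: measurable_funD => //.
  exact: measurable_re_part.
have F0 n m N w : (0 <= F n m N w)%E.
  by rewrite lee_fin; apply: prodr_ge0 => k _; exact: expR_ge0.
have FH n m N : (\int[P]_w F n m N w <= (rho ^+ n)%:E)%E.
  exact: damping_prod.
(* Successive limits inferior, over N and over m. *)
pose G n m w := limn_einf (F n m ^~ w).
have mG n m : measurable_fun setT (G n m) by exact: measurable_limn_einf.
have G0 n m w : (0 <= G n m w)%E by exact: limn_einf_ge0.
have GH n m : (\int[P]_w G n m w <= (rho ^+ n)%:E)%E.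
  exact: integral_limn_einf_le.
pose H n w := limn_einf (G n ^~ w).
have mH n : measurable_fun setT (H n) by exact: measurable_limn_einf.
have H0 n w : (0 <= H n w)%E by exact: limn_einf_ge0.
have HH n : (\int[P]_w H n w <= (rho ^+ n)%:E)%E.
  exact: integral_limn_einf_le.
(* On the set B the function H n is at least expR (- M), whatever n. *)
pose L j n : set Omega := [set w | ((expR (- j%:R))%:E <= H n w)%E].
have mL j n : measurable (L j n).
  rewrite -[X in measurable X]setTI; exact: emeasurable_fun_c_infty.
have PL j n : (P (L j n) <= (expR j%:R * rho ^+ n)%:E)%E.
  have : ((expR (- j%:R))%:E * P (L j n) <= (rho ^+ n)%:E)%E.
    apply: le_trans (HH n).
    rewrite -(setIT (L j n)) -integral_indic// -ge0_integralZl//=; last first.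
      exact/measurable_EFinP.
    apply: ge0_le_integral => //=.
    - by apply: emeasurable_funM => //; exact/measurable_EFinP.
    move=> w _; rewrite indicE; have [/set_mem|_] := boolP (w \in _).
      by rewrite mule1.
    by rewrite mule0.
  have /fineK <- : P (L j n) \is a fin_num by exact: fin_num_measure.
  by rewrite -EFinM !lee_fin expRN mulrC ler_pdivrMr ?expR_gt0// mulrC.
have PL0 j : P (\bigcap_n L j n) = 0%E.
  apply/eqP; rewrite eq_le measure_ge0 andbT.
  have cv : (expR j%:R * rho ^+ n)%:E @[n --> \oo] --> (0 : \bar R).
    apply: cvg_EFin; first exact: nearW.
    rewrite -[X in _ --> X](mulr0 (expR j%:R)).
    apply: cvgMr; apply: cvg_expr; by rewrite ger0_norm.
  rewrite -(cvg_lim _ cv)//; apply: lime_ge; first by apply/cvg_ex; exists 0%E.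
  apply: nearW => n; apply: le_trans (PL j n).
  apply: le_measure; rewrite ?inE//.
  - exact: bigcapT_measurable.
  - by move=> w; apply.
apply: (@negligibleS _ _ _ _ (\bigcup_j \bigcap_n L j n)); last first.
  apply: negligible_bigcup => j.
  by apply/negligibleP; [exact: bigcapT_measurable|exact: PL0].
move=> w /HB[M HM].
have [j jM] : exists j : nat, M <= j%:R.
  by exists (Num.trunc `|M|).+1; apply: le_trans (ler_norm M) _; apply: ltW;
    rewrite truncnS_gt.
exists j => // n _; rewrite /L /=.
have [b [c [bM cb rc]]] := HM n.
have GE m : G n m w = (\prod_(k < n) expR (- c m k ^+ 2))%:E.
  rewrite /G; apply: (fst (cvg_limn_einf_sup _)).
  apply: cvg_EFin; first exact: nearW.
  apply: (@cvg_gauss_prod _ _ (fun k N => re_part (Z k) w + r n m N k w) (c m)).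
  by move=> k; exact: rc.
have -> : H n w = (\prod_(k < n) expR (- b k ^+ 2))%:E.
  apply: (fst (cvg_limn_einf_sup _)).
  under eq_fun do rewrite GE.
  apply: cvg_EFin; first exact: nearW.
  by apply: (@cvg_gauss_prod _ _ (fun k m => c m k)).
rewrite lee_fin -expR_sum ler_expR sumrN lerN2; exact: le_trans bM jM.
Qed.
End null.

(** * The metric on a fiber *)

Section fiber.
Context (R : realType) (n : nat) (X : complex_manifold R n).
Variables (L : line_bundle X) (h : hermitian_metric L).

(** Real part of the metric: a Euclidean inner product on the fiber, seen as a real
    vector space. *)
Definition hre (x : X) (u v : L x) : R := complex.Re (hprod h u v).
(** Imaginary part of the metric. *)
Definition him (x : X) (u v : L x) : R := complex.Im (hprod h u v).

Section fixed_point.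
Variable x : X.
Implicit Types (u v w : L x) (c : R[i]).

Lemma ReM (z w : R[i]) : complex.Re (z * w) =
  complex.Re z * complex.Re w - complex.Im z * complex.Im w.
Proof. by case: z; case: w. Qed.

Lemma hprodDl u v w : hprod h (u + v) w = hprod h u w + hprod h v w.
Proof. by have := hprod_linear h 1 u v w; rewrite scale1r mul1r. Qed.

Lemma hprod0l w : hprod h (0 : L x) w = 0.
Proof.
have := hprodDl 0 0 w; rewrite addr0 => /eqP.
by rewrite -subr_eq0 opprD addrA subrr sub0r oppr_eq0 => /eqP.
Qed.

Lemma hprodZl c u w : hprod h (c *: u) w = c * hprod h u w.
Proof. by have := hprod_linear h c u 0 w; rewrite addr0 hprod0l addr0. Qed.

Lemma hreC u v : hre u v = hre v u.
Proof. by rewrite /hre (hprod_conj h v u); case: hprod. Qed.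

Lemma hreDl u v w : hre (u + v) w = hre u w + hre v w.
Proof. by rewrite /hre hprodDl raddfD. Qed.

Lemma hreZl c u w : hre (c *: u) w =
  complex.Re c * hre u w - complex.Im c * him u w.
Proof. by rewrite /hre hprodZl ReM. Qed.

Lemma hreZRl (t : R) u w : hre (t%:C%C *: u) w = t * hre u w.
Proof. by rewrite hreZl /= mul0r subr0. Qed.

Lemma hre0l w : hre (0 : L x) w = 0.
Proof. by rewrite /hre hprod0l. Qed.

Lemma hreNl u w : hre (- u) w = - hre u w.
Proof.
by apply/eqP; rewrite -subr_eq0 opprK -hreDl addNr hre0l.
Qed.

Lemma hreDr u v w : hre w (u + v) = hre w u + hre w v.
Proof. by rewrite hreC hreDl !(hreC _ w). Qed.

Lemma hreNr u w : hre w (- u) = - hre w u.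
Proof. by rewrite hreC hreNl hreC. Qed.

Lemma hreZRr (t : R) u w : hre w (t%:C%C *: u) = t * hre w u.
Proof. by rewrite hreC hreZRl hreC. Qed.

Lemma hre_suml (I : Type) (r : seq I) (F : I -> L x) w :
  hre (\sum_(i <- r) F i) w = \sum_(i <- r) hre (F i) w.
Proof.
elim: r => [|i r IH]; first by rewrite !big_nil hre0l.
by rewrite !big_cons hreDl IH.
Qed.

Lemma hre_ge0 u : 0 <= hre u u.
Proof.
have [->|u0] := eqVneq u 0; first by rewrite hre0l.
by have := hprod_posdef h u0; rewrite ltcE /= => /andP[_ /ltW].
Qed.

Lemma hre_eq0 u : hre u u = 0 -> u = 0.
Proof.
have [->//|u0] := eqVneq u 0.
have := hprod_posdef h u0; rewrite ltcE /= => /andP[_].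
by rewrite /hre => /[swap] ->; rewrite ltxx.
Qed.

Lemma hnorm_ge0 u : 0 <= hnorm h u. Proof. exact: sqrtr_ge0. Qed.

Lemma sqr_hnorm u : hnorm h u ^+ 2 = hre u u.
Proof. by rewrite /hnorm sqr_sqrtr// hre_ge0. Qed.

Lemma hnorm_eq0 u : hnorm h u = 0 -> u = 0.
Proof. by move=> u0; apply: hre_eq0; rewrite -sqr_hnorm u0 expr0n. Qed.

Lemma hre_cauchy u v : `|hre u v| <= hnorm h u * hnorm h v.
Proof.
rewrite -ler_sqr ?nnegrE ?normr_ge0 ?mulr_ge0 ?hnorm_ge0//.
rewrite exprMn !sqr_hnorm real_normK ?num_real//.
have [vv0|vv0] := eqVneq (hre v v) 0.
  by rewrite (hre_eq0 vv0) hreC !hre0l expr0n mulr0.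
have vp : 0 < hre v v by rewrite lt_def vv0 hre_ge0.
have := hre_ge0 ((hre v v)%:C%C *: u - (hre u v)%:C%C *: v).
rewrite hreDl !hreDr !hreNl !hreNr !hreZRl !hreZRr (hreC v u).
set a := hre u u; set b := hre u v; set c := hre v v in vp *.
move=> H; have : 0 <= c * (a * c - b ^+ 2).
  by apply: le_trans H _; rewrite le_eqVlt; apply/orP; left; apply/eqP; ring.
by rewrite pmulr_rge0// subr_ge0.
Qed.

Lemma hnormZ_i u : hnorm h ('i%C *: u) = hnorm h u.
Proof.
rewrite /hnorm hprodZl (hprod_conj h ('i%C *: u) u) hprodZl.
congr Num.sqrt; case: (hprod h u u) => a b /=.
by rewrite !(mul0r, mul1r, sub0r, add0r, opprK).
Qed.

Lemma him_cauchy u v : `|him u v| <= hnorm h u * hnorm h v.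
Proof.
have -> : him u v = - hre ('i%C *: u) v.
  by rewrite hreZl /= mul0r mul1r sub0r opprK.
by rewrite normrN -(hnormZ_i u) hre_cauchy.
Qed.

Lemma hre_combination (c : nat -> R[i]) (S : nat -> bundle_section L) N w :
  hre (combination c S N x) w = \sum_(j < N)
    (complex.Re (c j) * hre (S j x) w - complex.Im (c j) * him (S j x) w).
Proof.
by rewrite /combination hre_suml; apply: eq_bigr => j _; rewrite hreZl.
Qed.

End fixed_point.
End fiber.

(** * Continuity of products of holomorphic sections *)

Section complex_parts_continuous.
Context (R : realType).

Lemma continuous_Re : continuous (@complex.Re R : R[i] -> R).
Proof.
move=> z; apply/(@cvgrPdist_lt _ _ _ _ (nbhs_filter z)) => e e0.
have e0' : 0 < e%:C%C :> R[i] by rewrite ltcR.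
have zB : nbhs z (ball z e%:C%C) by exact: nbhsx_ballx.
apply: (@filterS _ _ (nbhs_filter z) _ _ _ zB) => w; rewrite -ball_normE /= -ltcR; apply: le_lt_trans.
rewrite -(raddfB (@complex.Re R : Rcomplex R -> R)); exact: normc_ge_Re.
Qed.

Lemma ImB_Re (z w : R[i]) :
  complex.Im z - complex.Im w = complex.Re ('i%C * (w - z)).
Proof. by case: z; case: w => a b c d /=; ring. Qed.

Lemma norm_imag : `|'i%C| = 1 :> R[i].
Proof. by rewrite normc_def /= expr0n /= expr1n add0r sqrtr1. Qed.

Lemma norm_real_complex (t : R) : `|t%:C%C| = `|t|%:C%C :> R[i].
Proof. by rewrite normc_def /= expr0n /= addr0 sqrtr_sqr. Qed.

Lemma gt0_real_complex (e : R[i]) : 0 < e ->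
  exists2 r : R, 0 < r & e = r%:C%C.
Proof.
rewrite ltcE /= => /andP[/eqP e2 e1]; exists (complex.Re e) => //.
by case: e e1 e2 => a b /= _ ->.
Qed.

Lemma continuous_Im : continuous (@complex.Im R : R[i] -> R).
Proof.
move=> z; apply/(@cvgrPdist_lt _ _ _ _ (nbhs_filter z)) => e e0.
have e0' : 0 < e%:C%C :> R[i] by rewrite ltcR.
have zB : nbhs z (ball z e%:C%C) by exact: nbhsx_ballx.
apply: (@filterS _ _ (nbhs_filter z) _ _ _ zB) => w.
rewrite -ball_normE /= -ltcR; apply: le_lt_trans.
rewrite ImB_Re; apply: le_trans (normc_ge_Re _) _.
by rewrite normrM norm_imag mul1r distrC.
Qed.
End complex_parts_continuous.

Section continuity.
Context (R : realType) (n : nat) (X : complex_manifold R n).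

(** Continuity is local and may be checked in charts. *)
Lemma continuous_from_charts (T : topologicalType) (U : set X) (F : X -> T) :
  open U ->
  (forall a z, (chart a @` (U `&` chart_dom a)) z ->
    {for z, continuous (F \o chart_inv a)}) ->
  forall x, U x -> {for x, continuous F}.
Proof.
move=> oU HF x Ux; have [a ax] := chart_cover x.
have cF : (F \o chart_inv a) \o chart a @ x --> F x.
  rewrite -[in X in _ --> X](chartK ax).
  apply: (cvg_comp (chart a) (F \o chart_inv a)); first exact: chart_continuous.
  by apply: HF; exists x.
apply: cvg_trans cF; apply: near_eq_cvg.
have : nbhs x (chart_dom a) by apply: open_nbhs_nbhs; split => //; exact: chart_dom_open.
by apply: filterS => y ay /=; rewrite chartK.
Qed.

Lemma holomorphic_on_continuous (U : set X) (f : X -> R[i]) : open U ->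
  holomorphic_on U f -> forall x, U x -> {for x, continuous f}.
Proof.
move=> oU hf; apply: continuous_from_charts => // a z az.
exact: (differentiable_continuous (hf a z az)).
Qed.

Lemma smooth_on_continuous_Re (U : set X) (f : X -> R[i]) : open U ->
  smooth_on U f -> forall x, U x -> {for x, continuous (@complex.Re R \o f)}.
Proof.
move=> oU hf; apply: continuous_from_charts => // a z az.
by have [[cRe _] _] := hf a 0%N; exact: cRe.
Qed.

Variables (L : line_bundle X) (h : hermitian_metric L).

(** In a local frame [e], with [s = f e] and [t = g e], the product of [s] and [t]
    is [f * conj g * h(e, e)], and [h(e, e)] is real. *)
Lemma hprod_sections_continuous (s t : bundle_section L) :
  holomorphic_section s -> holomorphic_section t ->
  continuous (fun x => hre h (s x) (t x)) /\
  continuous (fun x => him h (s x) (t x)).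
Proof.
move=> hs ht.
suff H (x : X) : {for x, continuous (fun x => hre h (s x) (t x))} /\
    {for x, continuous (fun x => him h (s x) (t x))}.
  by split=> x; have [] := H x.
have [a ax] := frame_cover L x.
have oa := frame_dom_open (l := L) a.
have [f hf sE] := hs a; have [g hg tE] := ht a.
pose e : X -> R := @complex.Re R \o (fun x => hprod h (frame a x) (frame a x)).
have ce : {for x, continuous e}.
  exact: (smooth_on_continuous_Re oa (hprod_smooth h a)).
have cf := holomorphic_on_continuous oa hf ax.
have cg := holomorphic_on_continuous oa hg ax.
have cRf : {for x, continuous (@complex.Re R \o f)}.
  exact: (@cvg_comp _ _ _ f (@complex.Re R) (nbhs x) (nbhs (f x)) (nbhs (complex.Re (f x))) cf (@continuous_Re R (f x))).
have cIf : {for x, continuous (@complex.Im R \o f)}.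
  exact: (@cvg_comp _ _ _ f (@complex.Im R) (nbhs x) (nbhs (f x)) (nbhs (complex.Im (f x))) cf (@continuous_Im R (f x))).
have cRg : {for x, continuous (@complex.Re R \o g)}.
  exact: (@cvg_comp _ _ _ g (@complex.Re R) (nbhs x) (nbhs (g x)) (nbhs (complex.Re (g x))) cg (@continuous_Re R (g x))).
have cIg : {for x, continuous (@complex.Im R \o g)}.
  exact: (@cvg_comp _ _ _ g (@complex.Im R) (nbhs x) (nbhs (g x)) (nbhs (complex.Im (g x))) cg (@continuous_Im R (g x))).
have hE y : frame_dom a y -> hprod h (s y) (t y) =
    f y * ((g y)^*)%C * (e y)%:C%C.
  move=> ay; rewrite sE// tE// hprodZl hprod_conj hprodZl rmorphM/= mulrA.
  congr (_ * _); rewrite /e /= -[RHS]conjc_real.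
  have := hprod_conj h (frame a y) (frame a y).
  by case: (hprod h (frame a y) (frame a y)) => p q [] /= qE; congr (_ +i* _)%C; lra.
have nx : nbhs x (frame_dom a) by apply: open_nbhs_nbhs.
split.
- have cF : (complex.Re (f y) * complex.Re (g y) +
     complex.Im (f y) * complex.Im (g y)) * e y @[y --> x] -->
    hre h (s x) (t x).
    have -> : hre h (s x) (t x) = (complex.Re (f x) * complex.Re (g x) +
      complex.Im (f x) * complex.Im (g x)) * e x.
      rewrite /hre hE//; case: (f x) => p q; case: (g x) => u v /=; ring.
    by apply: cvgM => //; apply: cvgD; apply: cvgM.
  apply: cvg_trans cF; apply: near_eq_cvg; apply: filterS nx => y ay /=.
  by rewrite /hre hE//; case: (f y) => p q; case: (g y) => u v /=; ring.
- have cF : (complex.Im (f y) * complex.Re (g y) -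
     complex.Re (f y) * complex.Im (g y)) * e y @[y --> x] -->
    him h (s x) (t x).
    have -> : him h (s x) (t x) = (complex.Im (f x) * complex.Re (g x) -
      complex.Re (f x) * complex.Im (g x)) * e x.
      rewrite /him hE//; case: (f x) => p q; case: (g x) => u v /=; ring.
    by apply: cvgM => //; apply: cvgB; apply: cvgM.
  apply: cvg_trans cF; apply: near_eq_cvg; apply: filterS nx => y ay /=.
  by rewrite /him hE//; case: (f y) => p q; case: (g y) => u v /=; ring.
Qed.

Lemma continuous_borel_measurable (F : X -> R) : continuous F ->
  measurable_fun [set: borel X] (F : borel X -> R).
Proof.
move=> /continuousP cF; apply: (measurability _ (RGenOpens.measurableE R)).
move=> _ [_ [a [b ->]] <-]; rewrite setTI; apply: sub_sigma_algebra.
by apply: cF; exact: interval_open.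
Qed.

End continuity.

(** * Exhaustion of the manifold by compact sets *)

Section compact_exhaustion.
Context (R : realType).

(** The identification of the real plane with the complex line. *)
Definition complex_of_pair (p : R * R) : R[i] := (p.1 +i* p.2)%C.

Lemma continuous_complex_of_pair : continuous complex_of_pair.
Proof.
move=> p A /nbhs_ballP[e /= e0 eA].
have [e' e'0 ee'] := gt0_real_complex e0.
have e20 : 0 < e' / 2 by rewrite divr_gt0.
exists (ball p.1 (e' / 2), ball p.2 (e' / 2)).
  by split; exact: nbhsx_ballx.
move=> [x y] /= [bx byy]; apply: eA; rewrite ee' -ball_normE /=.
move: bx byy; rewrite -!ball_normE /= => bx byy.
have -> : complex_of_pair p - complex_of_pair (x, y) =
    (p.1 - x)%:C%C + 'i%C * (p.2 - y)%:C%C.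
  by rewrite /complex_of_pair; simpc.
apply: le_lt_trans (ler_normD _ _) _.
rewrite normrM norm_imag mul1r !norm_real_complex -raddfD /= ltcR [ltRHS](splitr e').
exact: ltrD.
Qed.

(** The closed square of center [z] and half-side [r]; its compactness comes from
    that of real segments. *)
Definition complex_square (z : R[i]) (r : R) : set R[i] :=
  [set w | `|complex.Re w - complex.Re z| <= r /\
           `|complex.Im w - complex.Im z| <= r].

Lemma complex_square_compact z r : compact (complex_square z r).
Proof.
have -> : complex_square z r = complex_of_pair @`
    (`[complex.Re z - r, complex.Re z + r] `*`
     `[complex.Im z - r, complex.Im z + r]).
  apply/seteqP; split => [w [wR wI]|_ [[x y] /= [xR yI] <-]].
  - exists (complex.Re w, complex.Im w); last by case: w {wR wI}.
    by split; rewrite /= in_itv/= -ler_distl.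
  - by split => /=; rewrite ler_distl; [move: xR|move: yI]; rewrite in_itv.
apply: continuous_compact.
  exact/continuous_subspaceT/continuous_complex_of_pair.
by apply: compact_setX; exact: segment_compact.
Qed.

Lemma ball_complex_square (z : R[i]) (r : R) :
  ball z r%:C%C `<=` complex_square z r.
Proof.
move=> w; rewrite -ball_normE /= => zw; split; rewrite distrC -lecR;
  apply: le_trans (ltW zw).
- rewrite -(raddfB (@complex.Re R : Rcomplex R -> R)); exact: normc_ge_Re.
- rewrite ImB_Re; apply: le_trans (normc_ge_Re _) _.
  by rewrite normrM norm_imag mul1r distrC.
Qed.

Lemma complex_square_sub_ball (e : R[i]) : 0 < e ->
  exists2 r, 0 < r & forall z, complex_square z r `<=` ball z e.
Proof.
move=> /gt0_real_complex[e' e'0 ->].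
exists (e' / 3); first by rewrite divr_gt0.
move=> z w [wR wI]; rewrite -ball_normE /= distrC.
have -> : w - z = (complex.Re w - complex.Re z)%:C%C +
    'i%C * (complex.Im w - complex.Im z)%:C%C.
  by case: w {wR wI} => a b; case: z => c d; simpc.
apply: le_lt_trans (ler_normD _ _) _.
rewrite normrM norm_imag mul1r !norm_real_complex -raddfD /= ltcR.
by apply: le_lt_trans (lerD wR wI) _; lra.
Qed.

(** The product of closed squares around the coordinates of [z]. *)
Definition Cn_cube n (z : 'rV[R[i]]_n) (r : R) : set 'rV[R[i]]_n :=
  [set v | forall i, complex_square (z ord0 i) r (v ord0 i)].

Lemma Cn_cube_compact n (z : 'rV[R[i]]_n) r : compact (Cn_cube z r).
Proof.
apply: (@rV_compact _ _ (fun i => complex_square (z ord0 i) r)) => i.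
exact: complex_square_compact.
Qed.

Lemma Cn_cube_nbhs n (z : 'rV[R[i]]_n) r : 0 < r -> nbhs z (Cn_cube z r).
Proof.
move=> r0; apply/nbhs_ballP; exists (r%:C%C) => /=; first by rewrite ltcR.
by move=> v [_ zv] i; exact: ball_complex_square.
Qed.

Lemma Cn_cube_sub n (z : 'rV[R[i]]_n) (O : set 'rV[R[i]]_n) : nbhs z O ->
  exists2 r, 0 < r & Cn_cube z r `<=` O.
Proof.
move=> /nbhs_ballP[e /= e0 eO]; have [r r0 rB] := complex_square_sub_ball e0.
exists r => // v zv; apply: eO; split => // i j; rewrite ord1; exact/rB/zv.
Qed.

End compact_exhaustion.

Section manifold_exhaustion.
Context (R : realType) (n : nat) (X : complex_manifold R n).

Lemma manifold_locally_compact (x : X) : exists2 K : set X, compact K & nbhs x K.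
Proof.
have [a ax] := chart_cover x; pose z := chart a x.
have oz : nbhs z (chart a @` chart_dom a).
  by apply: open_nbhs_nbhs; split; [exact: chart_image_open|exists x].
have [r r0 rO] := Cn_cube_sub oz.
exists (chart_inv a @` Cn_cube z r).
  apply: continuous_compact; last exact: Cn_cube_compact.
  apply: continuous_in_subspaceT => y /set_mem yr.
  exact/chart_inv_continuous/rO.
have nK := chart_continuous ax (Cn_cube_nbhs z r0).
have nD : nbhs x (chart_dom a).
  by apply: open_nbhs_nbhs; split => //; exact: chart_dom_open.
have nKD : nbhs x (chart a @^-1` Cn_cube z r `&` chart_dom a).
  exact: (@filterI _ _ (nbhs_filter x)).
apply: (@filterS _ _ (nbhs_filter x) _ _ _ nKD) => y [yr ay].
by exists (chart a y) => //; exact: chartK.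
Qed.

(** The sets [C m] are finite unions of compact sets, one for each member of a
    countable basis that is contained in some compact set; every point has such
    a basic neighborhood. *)
Lemma manifold_exhaustion : exists C : nat -> set X,
  (forall m, compact (C m)) /\
  (forall x, exists m0, forall m, (m0 <= m)%N -> C m x).
Proof.
have [B /countable_injP[f fI] [oB bB]] := manifold_second_countable X.
(* The basis is numbered by the injection f; K is good for i when it is a compact
   set containing the basic open set of number i. *)
pose good i (K : set X) := compact K /\
  exists U, [/\ B U, f U = i & U `<=` K].
pose D i := if pselect (exists K, good i K) is left e then sval (cid e) else set0.
have cD i : compact (D i).
  rewrite /D; case: pselect => [e|_]; last exact: compact0.
  by case: (svalP (cid e)).
exists (fun m => \big[setU/set0]_(i < m) D i); split.
  by move=> m; apply: big_ind => //; [exact: compact0|exact: compactU].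
move=> x; have [K cK nK] := manifold_locally_compact x.
have [U [BU Ux] UK] := bB x _ nK.
exists (f U).+1 => m fUm; rewrite -bigcup_mkord; exists (f U) => //=.
rewrite /D; case: pselect => [e|]; last by case; exists K; split => //; exists U.
have [_ [V [BV fVU VK]]] := svalP (cid e); apply: VK.
by rewrite (fI V U) ?inE.
Qed.

End manifold_exhaustion.

(** * Square-integrable sections and the Bessel inequality *)

Section real_integrable.
Context (R : realType) (d : measure_display) (T : measurableType d).
Variables (mu : {measure set T -> \bar R}).

Lemma rintegrableD D (f g : T -> R) : measurable D ->
  mu.-integrable D (EFin \o f) -> mu.-integrable D (EFin \o g) ->
  mu.-integrable D (EFin \o (fun x => f x + g x)).
Proof. by move=> mD fi gi; exact: (integrableD mD fi gi). Qed.

Lemma rintegrableZl D c (f : T -> R) : measurable D ->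
  mu.-integrable D (EFin \o f) -> mu.-integrable D (EFin \o (fun x => c * f x)).
Proof. by move=> mD fi; exact: (integrableZl mD c fi). Qed.

Lemma Rintegral_sum D (I : Type) (r : seq I) (f : I -> T -> R) : measurable D ->
  (forall i, mu.-integrable D (EFin \o f i)) ->
  mu.-integrable D (EFin \o (fun x => \sum_(i <- r) f i x)) /\
  (\int[mu]_(x in D) \sum_(i <- r) f i x = \sum_(i <- r) \int[mu]_(x in D) f i x)%R.
Proof.
move=> mD fi; elim: r => [|i r [IHi IHe]].
  split; last by rewrite big_nil; under eq_Rintegral do rewrite big_nil;
    rewrite Rintegral_cst ?mul0r.
  by under [X in _.-integrable _ (EFin \o X)]eq_fun do rewrite big_nil; exact: integrable0.
under [X in _.-integrable _ (EFin \o X)]eq_fun do rewrite big_cons.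
under eq_Rintegral do rewrite big_cons.
split; first exact: rintegrableD.
by rewrite RintegralD// IHe big_cons.
Qed.

(** The sets [K m] need not be nested: each point where [F] does not vanish belongs
    to all of them from some rank on.  Dominated convergence applies. *)
Lemma cvg_Rintegral_exhaustion (K : nat -> set T) (F : T -> R) :
  (forall m, measurable (K m)) -> mu.-integrable setT (EFin \o F) ->
  (forall x, F x != 0 -> \forall m \near \oo, K m x) ->
  (\int[mu]_(x in K m) F x)%R @[m --> \oo] --> (\int[mu]_x F x)%R.
Proof.
move=> mK iF KF; have mF : measurable_fun setT F.
  by apply/measurable_EFinP; exact: measurable_int iF.
under eq_fun do rewrite Rintegral_mkcond.
apply: fine_cvg; rewrite fineK; last exact: integrable_fin_num.
have := @dominated_cvg _ _ _ mu setT measurableT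
   (fun m => EFin \o (F \_ (K m))) (EFin \o F) (fun x => `|(F x)%:E|%E).
apply.
- move=> m; apply/measurable_EFinP.
  by apply/(measurable_restrictT F) => //; exact: measurable_funTS.
- move=> x _; apply: cvg_near_cst; have [F0|Fx] := eqVneq (F x) 0.
    by apply: nearW => m /=; rewrite patchE F0; case: ifP.
  by apply: filterS (KF x Fx) => m Km /=; rewrite patchE mem_set.
- by [].
- exact: integrable_abse.
- move=> m x _ /=; rewrite lee_fin patchE; case: ifP => //.
  by rewrite normr0.
Qed.

End real_integrable.

Section sections.
Context (R : realType) (n : nat) (X : complex_manifold R n).
Variables (mu : {measure set (borel X) -> \bar R}).
Variables (L : line_bundle X) (h : hermitian_metric L).

Lemma holomorphic_section_lincomb (c : R[i]) (s t : bundle_section L) :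
  holomorphic_section s -> holomorphic_section t ->
  holomorphic_section (fun x => s x + c *: t x).
Proof.
move=> hs ht a; have [f hf sE] := hs a; have [g hg tE] := ht a.
exists (fun x => f x + c * g x); last first.
  by move=> x ax; rewrite sE// tE// scalerA -scalerDl.
move=> b z bz; apply: (differentiableD (hf b z bz)).
exact: (differentiableZ c (hg b z bz)).
Qed.

Lemma holomorphic_section_combination (c : nat -> R[i])
  (S : nat -> bundle_section L) N : (forall j, holomorphic_section (S j)) ->
  holomorphic_section (combination c S N).
Proof.
move=> hS; elim: N => [|N IH].
  move=> a; exists (fun=> 0); last first.
    by move=> x ax; rewrite /combination big_ord0 scale0r.
  move=> b z bz; exact: differentiable_cst.
have -> : combination c S N.+1 = fun x => combination c S N x + c N *: S N x.
  by apply/functional_extensionality_dep => x; rewrite /combination big_ord_recr.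
exact: holomorphic_section_lincomb.
Qed.

Lemma hre_measurable (s t : bundle_section L) :
  holomorphic_section s -> holomorphic_section t ->
  measurable_fun [set: borel X] (fun x : borel X => hre h (s x) (t x)).
Proof.
move=> hs ht; apply: continuous_borel_measurable.
by have [] := hprod_sections_continuous h hs ht.
Qed.

Lemma him_measurable (s t : bundle_section L) :
  holomorphic_section s -> holomorphic_section t ->
  measurable_fun [set: borel X] (fun x : borel X => him h (s x) (t x)).
Proof.
move=> hs ht; apply: continuous_borel_measurable.
by have [] := hprod_sections_continuous h hs ht.
Qed.

(** The real function [|u|^2] is integrable; this includes its measurability. *)
Definition sqint (u : bundle_section L) := mu.-integrable [set: borel X]
  (EFin \o (fun x : borel X => hre h (u x) (u x))).

Lemma sqintP (u : bundle_section L) :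
  measurable_fun [set: borel X] (fun x : borel X => hre h (u x) (u x)) ->
  L2_integrable mu h u -> sqint u.
Proof.
move=> mu' L2; apply/integrableP; split; first exact/measurable_EFinP.
rewrite /L2_integrable /sqnorm_L2 in L2; apply: le_lt_trans L2.
rewrite le_eqVlt; apply/orP; left; apply/eqP; apply: eq_integral => x _ /=.
by rewrite sqr_hnorm ger0_norm// hre_ge0.
Qed.

Lemma hnormM_le (x : X) (u v : L x) :
  hnorm h u * hnorm h v <= hre h u u + hre h v v.
Proof.
rewrite -!sqr_hnorm; have := hnorm_ge0 h u; have := hnorm_ge0 h v.
by move: (hnorm h u) (hnorm h v) => a b; nra.
Qed.

Lemma integrable_dominated_hnormM (F : borel X -> R) (u v : bundle_section L) :
  measurable_fun setT F -> sqint u -> sqint v ->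
  (forall x, `|F x| <= hnorm h (u x) * hnorm h (v x)) ->
  mu.-integrable [set: borel X] (EFin \o F).
Proof.
move=> mF iu iv Fuv.
apply: (le_integrable _ _ _ (rintegrableD measurableT iu iv)) => //.
  exact/measurable_EFinP.
move=> x _ /=; rewrite lee_fin; apply: le_trans (Fuv x) _.
by apply: le_trans (hnormM_le _ _) (ler_norm _).
Qed.

Variable S : nat -> bundle_section L.
Hypothesis S_H02 : forall j, H02 mu h (S j).
Hypothesis S_orthonormal : forall j k, inner_L2 mu h (S j) (S k) = (j == k)%:R.

Lemma sqint_basis j : sqint (S j).
Proof.
by apply: sqintP; [apply: hre_measurable|]; have [] := S_H02 j.
Qed.

Lemma integrable_hre_basis j k : mu.-integrable [set: borel X]
  (EFin \o (fun x : borel X => hre h (S j x) (S k x))).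
Proof.
apply: (integrable_dominated_hnormM _ (sqint_basis j) (sqint_basis k)).
  by apply: hre_measurable; have [] := S_H02 j; have [] := S_H02 k.
by move=> x; exact: hre_cauchy.
Qed.

Lemma integrable_him_basis j k : mu.-integrable [set: borel X]
  (EFin \o (fun x : borel X => him h (S j x) (S k x))).
Proof.
apply: (integrable_dominated_hnormM _ (sqint_basis j) (sqint_basis k)).
  by apply: him_measurable; have [] := S_H02 j; have [] := S_H02 k.
by move=> x; exact: him_cauchy.
Qed.

Lemma Rintegral_hre_basis j k :
  (\int[mu]_(x in [set: borel X]) hre h (S j x) (S k x))%R = (j == k)%:R.
Proof.
have := congr1 (@complex.Re R) (S_orthonormal j k).
by rewrite /= => ->; case: (j == k).
Qed.

Lemma Rintegral_him_basis j k :
  (\int[mu]_(x in [set: borel X]) him h (S j x) (S k x))%R = 0.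
Proof.
have := congr1 (@complex.Im R) (S_orthonormal j k).
by rewrite /= => ->; case: (j == k).
Qed.

(** For the real parts of the coefficients.  By induction on the number of basis
    vectors, the last component being subtracted from [u]. *)
Lemma bessel N (u : bundle_section L) : sqint u ->
  (forall k, measurable_fun setT (fun x : borel X => hre h (u x) (S k x))) ->
  \sum_(k < N) (\int[mu]_(x in [set: borel X]) hre h (u x) (S k x))%R ^+ 2 <=
  (\int[mu]_(x in [set: borel X]) hre h (u x) (u x))%R.
Proof.
elim: N u => [|N IH] u iu mu'.
  by rewrite big_ord0; apply: Rintegral_ge0 => x _; exact: hre_ge0.
have iuS k : mu.-integrable [set: borel X]
    (EFin \o (fun x : borel X => hre h (u x) (S k x))).
  apply: (integrable_dominated_hnormM (mu' k) iu (sqint_basis k)) => x.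
  exact: hre_cauchy.
pose b : R := (\int[mu]_(x in [set: borel X]) hre h (u x) (S N x))%R.
pose v : bundle_section L := fun x => u x + (- b)%:C%C *: S N x.
have vS k : (fun x : borel X => hre h (v x) (S k x)) =
    (fun x : borel X => hre h (u x) (S k x) + (- b) * hre h (S N x) (S k x)).
  by apply/funext => x; rewrite /v hreDl hreZRl.
have vv : (fun x : borel X => hre h (v x) (v x)) = (fun x : borel X =>
    hre h (u x) (u x) + ((- (2 * b)) * hre h (u x) (S N x) +
      b ^+ 2 * hre h (S N x) (S N x))).
  apply/funext => x; rewrite /v hreDl !hreDr hreZRl !hreZRr hreZRl.
  by rewrite (hreC h (S N x) (u x)); ring.
have ivv : sqint v.
  rewrite /sqint vv; apply: rintegrableD => //; apply: rintegrableD => //;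
    apply: rintegrableZl => //; exact: integrable_hre_basis.
have mv k : measurable_fun setT (fun x : borel X => hre h (v x) (S k x)).
  rewrite vS; apply: measurable_funD => //; apply: measurable_funM => //.
  by apply: hre_measurable; have [] := S_H02 N; have [] := S_H02 k.
have := IH v ivv mv.
have vb (k : 'I_N) : (\int[mu]_(x in [set: borel X]) hre h (v x) (S k x))%R =
    (\int[mu]_(x in [set: borel X]) hre h (u x) (S k x))%R.
  rewrite vS RintegralD//; last by apply: rintegrableZl => //; exact: integrable_hre_basis.
  rewrite RintegralZl//; last exact: integrable_hre_basis.
  by rewrite Rintegral_hre_basis gtn_eqF// mulr0 addr0.
under eq_bigr do rewrite vb.
rewrite vv RintegralD//; last first.
  by apply: rintegrableD => //; apply: rintegrableZl => //; exact: integrable_hre_basis.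
rewrite RintegralD//; last 2 first.
- exact: rintegrableZl.
- by apply: rintegrableZl => //; exact: integrable_hre_basis.
rewrite !RintegralZl//; last exact: integrable_hre_basis.
rewrite Rintegral_hre_basis eqxx mulr1 -/b => H.
rewrite big_ord_recr /= -/b; move: H; lra.
Qed.

End sections.

(** * Locally uniform limits of sections *)

Lemma cvg_dist_le (R : realType) (u : nat -> R) (l : R) (v : nat -> R) :
  v @ \oo --> 0 -> (forall N, `|u N - l| <= v N) -> u @ \oo --> l.
Proof.
move=> /cvgr0_norm_lt v0 uv; apply/cvgrPdist_lt => e e0.
apply: filterS (v0 e e0) => N vN; rewrite distrC.
by apply: le_lt_trans (uv N) _; apply: le_lt_trans (ler_norm _) vN.
Qed.

Section limits.
Context (R : realType) (n : nat) (X : complex_manifold R n).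
Variables (mu : {measure set (borel X) -> \bar R}).
Variables (L : line_bundle X) (h : hermitian_metric L).

Lemma cvg_uniformly_on_compact (f : nat -> bundle_section L) psi (C : set X) :
  cvg_locally_uniformly h f psi -> compact C -> forall e, 0 < e ->
  \forall N \near \oo, forall y, C y -> hnorm h (f N y - psi y) < e.
Proof.
move=> fpsi /compact_near_coveringP cC e e0.
apply: (cC nat \oo (fun N y => hnorm h (f N y - psi y) < e)) => x _.
have [U xU /(_ e e0) HU] := fpsi x.
by exists (U, [set N | forall y, U y -> hnorm h (f N y - psi y) < e]) => // -[y N] [/= Uy HN]; exact: HN.
Qed.

Lemma cvg_locally_uniformly_pointwise (f : nat -> bundle_section L) psi x :
  cvg_locally_uniformly h f psi -> hnorm h (f N x - psi x) @[N --> \oo] --> 0.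
Proof.
move=> fpsi; apply/cvgrPdist_lt => e e0.
have [U xU /(_ e e0)] := fpsi x; apply: filterS => N HN.
rewrite sub0r normrN ger0_norm ?hnorm_ge0//; apply: HN; exact: nbhs_singleton.
Qed.

Lemma hre_cvgl (f : nat -> bundle_section L) psi (x : X) (v : L x) :
  cvg_locally_uniformly h f psi ->
  hre h (f N x) v @[N --> \oo] --> hre h (psi x) v.
Proof.
move=> /(@cvg_locally_uniformly_pointwise _ _ x) fpsi.
apply: (@cvg_dist_le _ _ _ (fun N => hnorm h (f N x - psi x) * hnorm h v)).
  by rewrite -[X in _ --> X](mul0r (hnorm h v)); apply: cvgMl.
by move=> N; rewrite -hreNl -hreDl; exact: hre_cauchy.
Qed.

Lemma hre_cvg_diag (f : nat -> bundle_section L) psi (x : X) :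
  cvg_locally_uniformly h f psi ->
  hre h (f N x) (f N x) @[N --> \oo] --> hre h (psi x) (psi x).
Proof.
move=> /(@cvg_locally_uniformly_pointwise _ _ x) fpsi.
apply: (@cvg_dist_le _ _ _ (fun N => hnorm h (f N x - psi x) *
   (hnorm h (f N x - psi x) + 2 * hnorm h (psi x)))).
  rewrite -[X in _ --> X](mul0r (0 + 2 * hnorm h (psi x))); apply: cvgM => //.
  by apply: cvgD => //; exact: cvg_cst.
move=> N; have fE : f N x = psi x + (f N x - psi x) by rewrite addrC subrK.
move: (f N x - psi x) fE => w ->.
rewrite hreDl !hreDr (hreC h w (psi x)) mulrDr -expr2 sqr_hnorm.
have := hre_cauchy h (psi x) w; rewrite ler_norml => /andP[p1 p2].
have := hre_ge0 h w => w0.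
have -> : hnorm h w * (2 * hnorm h (psi x)) = 2 * (hnorm h (psi x) * hnorm h w).
  by ring.
move: p1 p2 w0; move: (hnorm h (psi x) * hnorm h w) (hre h w w) => a b.
move: (hre h (psi x) w) (hre h (psi x) (psi x)) => c d p1 p2 w0.
by rewrite ler_norml; apply/andP; split; lra.
Qed.

Lemma limit_hre_measurable (f : nat -> bundle_section L) psi t :
  (forall N, holomorphic_section (f N)) -> holomorphic_section t ->
  cvg_locally_uniformly h f psi ->
  measurable_fun setT (fun x : borel X => hre h (psi x) (t x)).
Proof.
move=> hf ht fpsi.
apply: (measurable_fun_cvg (h := fun N (x : borel X) => hre h (f N x) (t x))).
  by move=> N; exact: hre_measurable.
by move=> x _; exact: hre_cvgl.
Qed.

Lemma limit_hre_diag_measurable (f : nat -> bundle_section L) psi :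
  (forall N, holomorphic_section (f N)) ->
  cvg_locally_uniformly h f psi ->
  measurable_fun setT (fun x : borel X => hre h (psi x) (psi x)).
Proof.
move=> hf fpsi.
apply: (measurable_fun_cvg (h := fun N (x : borel X) => hre h (f N x) (f N x))).
  by move=> N; exact: hre_measurable.
by move=> x _; exact: hre_cvg_diag.
Qed.

(** Uniform convergence on [C] suffices: although [K] is not assumed of finite
    measure, [|t|] is integrable on [K] since it is bounded by a multiple of
    [|t|^2]. *)
Lemma cvg_Rintegral_on_compact (f : nat -> bundle_section L) psi t
    (C : set X) (K : set (borel X)) (M : R) :
  cvg_locally_uniformly h f psi -> compact C -> K `<=` C -> measurable K ->
  sqint mu h t -> mu.-integrable K (EFin \o (fun x => hre h (psi x) (t x))) ->
  (forall N, mu.-integrable K (EFin \o (fun x => hre h (f N x) (t x)))) ->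
  0 <= M -> (forall x, K x -> hnorm h (t x) <= M * hre h (t x) (t x)) ->
  (\int[mu]_(x in K) hre h (f N x) (t x))%R @[N --> \oo] -->
  (\int[mu]_(x in K) hre h (psi x) (t x))%R.
Proof.
move=> fpsi cC KC mK it ip iF M0 HM.
have itK : mu.-integrable K (EFin \o (fun x => hre h (t x) (t x))).
  exact: integrableS it.
pose I := (\int[mu]_(x in K) hre h (t x) (t x))%R.
have I0 : 0 <= I by apply: Rintegral_ge0 => x _; exact: hre_ge0.
apply/cvgrPdist_le => e e0.
pose e' := e / (M * I + 1).
have MI : 0 < M * I + 1 by rewrite ltr_wpDl// mulr_ge0.
have e'0 : 0 < e' by rewrite divr_gt0.
apply: filterS (cvg_uniformly_on_compact fpsi cC e'0) => N HN.
rewrite -RintegralB//.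
have iB : mu.-integrable K
    (EFin \o (fun x => hre h (psi x) (t x) - hre h (f N x) (t x))).
  exact: (integrableB mK ip (iF N)).
apply: le_trans (le_normr_Rintegral mK iB) _.
apply: (@le_trans _ _ (\int[mu]_(x in K) ((e' * M) * hre h (t x) (t x)))%R).
  apply: le_Rintegral => //.
  - exact: (integrable_norm iB).
  - exact: rintegrableZl.
  move=> x Kx; rewrite -hreNl -hreDl; apply: le_trans (hre_cauchy _ _ _) _.
  rewrite -mulrA; apply: ler_pM; rewrite ?hnorm_ge0//; last exact: HM.
  have -> : psi x - f N x = (- 1)%:C%C *: (f N x - psi x).
    by rewrite rmorphN1 scaleN1r opprB.
  rewrite /hnorm -/(hre _ _ _) hreZRl hreZRr mulN1r mulN1r opprK.
  by apply: ltW; apply: HN; exact: KC.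
rewrite RintegralZl// -/I.
have -> : e' * M * I = e * (M * I) / (M * I + 1) by rewrite /e'; ring.
by rewrite ler_pdivrMr// ler_pM2l// lerDl.
Qed.

End limits.

(** * Truncated Fourier coefficients and the theorem *)

Section truncation.
Context (R : realType) (n : nat) (X : complex_manifold R n).
Variables (mu : {measure set (borel X) -> \bar R}).
Variables (L : line_bundle X) (h : hermitian_metric L).
Variable S : nat -> bundle_section L.
Hypothesis S_H02 : forall j, H02 mu h (S j).
Hypothesis S_orthonormal : forall j k, inner_L2 mu h (S j) (S k) = (j == k)%:R.
Variable C : nat -> set X.
Hypothesis C_compact : forall m, compact (C m).
Hypothesis C_exhaust : forall x, exists m0, forall m, (m0 <= m)%N -> C m x.

Let hS j : holomorphic_section (S j). Proof. by have [] := S_H02 j. Qed.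

(** The part of the compact set [C m] where [|S_k| >= 1 / (m + 1)].  The lower bound
    makes [|S_k|] integrable on it, and discards in the limit only zeros of
    [S_k]. *)
Definition truncation (m k : nat) : set (borel X) :=
  C m `&` [set x | m.+1%:R^-1 <= hnorm h (S k x)].

Lemma truncation_measurable m k : measurable (truncation m k).
Proof.
apply: measurableI.
  have cl : closed (C m) by apply: compact_closed; [exact: manifold_hausdorff|].
  rewrite -[C m]setCK; apply: measurableC; apply: sub_sigma_algebra.
  exact: closed_openC.
have -> : [set x | m.+1%:R^-1 <= hnorm h (S k x)] =
    (fun x : borel X => hre h (S k x) (S k x)) @^-1` `[m.+1%:R^-1 ^+ 2, +oo[%classic.
  apply/seteqP; split => x /=;
    by rewrite in_itv/= andbT -sqr_hnorm ler_sqr ?nnegrE ?hnorm_ge0.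
rewrite -[X in measurable X]setTI; exact: (hre_measurable h (hS k) (hS k)).
Qed.

Lemma truncation_near k (x : X) : hnorm h (S k x) != 0 ->
  \forall m \near \oo, truncation m k x.
Proof.
move=> Sx; have Sx0 : 0 < hnorm h (S k x) by rewrite lt_def Sx hnorm_ge0.
have [m0 Hm0] := C_exhaust x.
near=> m; split; first by apply: Hm0; near: m; exists m0.
apply: ltW; near: m; exact: (near_infty_natSinv_lt (PosNum Sx0)).
Unshelve. all: by end_near. Qed.

Lemma truncation_hnorm_le m k (x : X) : truncation m k x ->
  hnorm h (S k x) <= m.+1%:R * hre h (S k x) (S k x).
Proof.
move=> [_ /= Hx]; rewrite -sqr_hnorm expr2 mulrA -[leLHS]mul1r.
by rewrite ler_wpM2r ?hnorm_ge0// mulrC -ler_pdivrMr// mul1r.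
Qed.

(** Real part of the inner product of [S_j] and [S_k] over the truncation. *)
Definition re_coef m j k : R :=
  (\int[mu]_(x in truncation m k) hre h (S j x) (S k x))%R.
(** Imaginary part of the same inner product. *)
Definition im_coef m j k : R :=
  (\int[mu]_(x in truncation m k) him h (S j x) (S k x))%R.
(** Real part of the inner product of [c_j S_j] and [S_k] over the truncation. *)
Definition trunc_term (c : nat -> R[i]) m k j : R :=
  complex.Re (c j) * re_coef m j k - complex.Im (c j) * im_coef m j k.

Lemma re_coef_cvg j k : re_coef m j k @[m --> \oo] --> ((j == k)%:R : R).
Proof.
rewrite -(Rintegral_hre_basis S_orthonormal).
apply: cvg_Rintegral_exhaustion.
- by move=> m; exact: truncation_measurable.
- exact: integrable_hre_basis.
move=> x Fx; apply: truncation_near; apply: contra_neq Fx => /hnorm_eq0 ->.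
by rewrite hreC hre0l.
Qed.

Lemma im_coef_cvg j k : im_coef m j k @[m --> \oo] --> (0 : R).
Proof.
rewrite -(Rintegral_him_basis S_orthonormal j k).
apply: cvg_Rintegral_exhaustion.
- by move=> m; exact: truncation_measurable.
- exact: integrable_him_basis.
move=> x Fx; apply: truncation_near; apply: contra_neq Fx => Sk0.
by apply/eqP; rewrite -normr_le0; apply: le_trans (him_cauchy _ _ _) _; rewrite Sk0 mulr0.
Qed.

(** By orthonormality, only the term [j = k] remains in the limit. *)
Lemma trunc_terms_cvg c k N : (k < N)%N ->
  \sum_(j < N) trunc_term c m k j @[m --> \oo] --> complex.Re (c k).
Proof.
move=> kN.
have -> : complex.Re (c k) = \sum_(j < N)
    (complex.Re (c j) * (nat_of_ord j == k)%:R - complex.Im (c j) * 0).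
  rewrite (bigD1 (Ordinal kN))//= eqxx mulr1 mulr0 subr0 big1 ?addr0// => j jk.
  have -> : (nat_of_ord j == k) = false.
    by apply/negbTE; apply: contra_neq jk => jk; exact: val_inj.
  by rewrite !mulr0 subr0.
apply: cvg_big => [|j _]; first exact: add_continuous.
apply: cvgB; apply: cvgMr; [exact: re_coef_cvg|exact: im_coef_cvg].
Qed.

Lemma Rintegral_combination (c : nat -> R[i]) m k N :
  mu.-integrable (truncation m k)
    (EFin \o (fun x => hre h (combination c S N x) (S k x))) /\
  (\int[mu]_(x in truncation m k) hre h (combination c S N x) (S k x))%R =
  \sum_(j < N) trunc_term c m k j.
Proof.
have mK := truncation_measurable m k.
have ire j : mu.-integrable (truncation m k)
    (EFin \o (fun x : borel X => hre h (S j x) (S k x))).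
  apply: integrableS (integrable_hre_basis S_H02 j k) => //.
have iim j : mu.-integrable (truncation m k)
    (EFin \o (fun x : borel X => him h (S j x) (S k x))).
  apply: integrableS (integrable_him_basis S_H02 j k) => //.
pose g j (x : borel X) := complex.Re (c j) * hre h (S j x) (S k x) +
  - complex.Im (c j) * him h (S j x) (S k x).
have ig j : mu.-integrable (truncation m k) (EFin \o g j).
  by apply: rintegrableD => //; exact: rintegrableZl.
have gE : (fun x : borel X => hre h (combination c S N x) (S k x)) =
    fun x => \sum_(j < N) g j x.
  apply/funext => x; rewrite hre_combination; apply: eq_bigr => j _.
  by rewrite /g mulNr.
rewrite gE; have [ii ->] := Rintegral_sum (index_enum 'I_N) mK (fun j : 'I_N => ig j).
split => //; apply: eq_bigr => j _.
by rewrite /g RintegralD//; [rewrite !RintegralZl// mulNr|exact: rintegrableZl|exact: rintegrableZl].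
Qed.

(** Here [b k] is the real part of the coefficient of [psi] along [S_k]; it is the
    iterated limit of [Re (c k)] plus a combination of the [c j], [n0 <= j].  In
    the limit over [N], the terms of index below [n0] do not change, and
    [l m k] contains their difference with [Re (c k)], which vanishes as [m]
    grows. *)
Lemma L2_limit_data (c : nat -> R[i]) (psi : bundle_section L) :
  cvg_locally_uniformly h (combination c S) psi -> L2_integrable mu h psi ->
  exists M : R, forall n0, exists (b : nat -> R) (l : nat -> nat -> R),
    [/\ \sum_(k < n0) b k ^+ 2 <= M,
      forall k, (k < n0)%N -> l ^~ k @ \oo --> b k &
      forall m k, (k < n0)%N ->
        complex.Re (c k) + \sum_(n0 <= j < N) trunc_term c m k j @[N --> \oo]
          --> l m k].
Proof.
move=> cpsi L2.
have hc N : holomorphic_section (combination c S N).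
  exact: holomorphic_section_combination.
have mpS k : measurable_fun setT (fun x : borel X => hre h (psi x) (S k x)).
  exact: (limit_hre_measurable hc (hS k) cpsi).
have ip : sqint mu h psi.
  exact: (sqintP (limit_hre_diag_measurable hc cpsi) L2).
have ipS k : mu.-integrable [set: borel X]
    (EFin \o (fun x : borel X => hre h (psi x) (S k x))).
  apply: (integrable_dominated_hnormM (mpS k) ip (sqint_basis S_H02 k)) => x.
  exact: hre_cauchy.
exists (\int[mu]_(x in [set: borel X]) hre h (psi x) (psi x))%R => n0.
pose b k : R := (\int[mu]_(x in [set: borel X]) hre h (psi x) (S k x))%R.
pose J m k : R := (\int[mu]_(x in truncation m k) hre h (psi x) (S k x))%R.
exists b, (fun m k => complex.Re (c k) - \sum_(j < n0) trunc_term c m k j + J m k).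
split.
- exact: (bessel S_H02 S_orthonormal).
- move=> k kn0.
  have -> : b k = complex.Re (c k) - complex.Re (c k) + b k.
    by rewrite subrr add0r.
  apply: cvgD.
    by apply: cvgB; [exact: cvg_cst|exact: (@trunc_terms_cvg c k n0 kn0)].
  apply: cvg_Rintegral_exhaustion => //.
    by move=> m; exact: truncation_measurable.
  move=> x Fx; apply: truncation_near; apply: contra_neq Fx => /hnorm_eq0 ->.
  by rewrite hreC hre0l.
- move=> m k kn0.
  have H : complex.Re (c k) - \sum_(j < n0) trunc_term c m k j +
     \sum_(j < N) trunc_term c m k j @[N --> \oo] -->
     complex.Re (c k) - \sum_(j < n0) trunc_term c m k j + J m k.
    apply: cvgD; first exact: cvg_cst.
    rewrite (_ : (fun N => _) = fun N : nat => (\int[mu]_(x in truncation m k)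
        hre h (combination c S N x) (S k x))%R); last first.
      by apply/funext => N; have [_ ->] := Rintegral_combination c m k N.
    apply: (@cvg_Rintegral_on_compact _ _ _ mu _ h _ psi (S k) (C m)
      (truncation m k) m.+1%:R) => //.
    + by move=> x [].
    + exact: truncation_measurable.
    + exact: sqint_basis.
    + apply: integrableS (ipS k) => //; exact: truncation_measurable.
    + by move=> N; have [] := Rintegral_combination c m k N.
    + by move=> x; exact: truncation_hnorm_le.
  apply: cvg_trans H; apply: near_eq_cvg; near=> N.
  have n0N : (n0 <= N)%N by near: N; exists n0.
  have -> : \sum_(j < N) trunc_term c m k j = \sum_(j < n0) trunc_term c m k j +
      \sum_(n0 <= j < N) trunc_term c m k j.
    by rewrite -(big_mkord xpredT (trunc_term c m k)) (@big_cat_nat _ _ _ n0)//= big_mkord.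
  by rewrite addrA subrK.
Unshelve. all: by end_near. Qed.

End truncation.

Theorem lemma2p5 (R : realType) (n : nat) (X : complex_manifold R n)
  (hX : connected [set: X])
  (Theta : hermitian_form X)
  (dV : {measure set (borel X) -> \bar R})
  (hdV : is_volume_measure Theta dV)
  (L : line_bundle X) (h : hermitian_metric L)
  (hdim : infinite_dimensional_H02 dV h)
  (S : nat -> bundle_section L)
  (hS : orthonormal_basis_H02 dV h S)
  (d : measure_display) (Omega : measurableType d) (P : probability Omega R)
  (eta : nat -> Omega -> R[i]%C)
  (heta : iid_std_complex_gaussian P eta)
  (psi : Omega -> bundle_section L)
  (hpsi : random_section_of h P eta S psi) :
  {ae P, forall w, ~ L2_integrable dV h (psi w)}.
Proof.
have [SH SO _] := hS.
have [C [C_compact C_exhaust]] := manifold_exhaustion X.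
(* Contribution of the variables of index at least n0. *)
pose r n0 m N k (w : Omega) : R :=
  \sum_(n0 <= j < N) trunc_term dV h S C (fun j => eta j w) m k j.
(* It is a finite linear combination, with constant coefficients, of
     the real and imaginary parts of those variables. *)
have mr n0 m N k : measurable_fun setT (r n0 m N k : tail eta n0 -> R).
  rewrite /r; under eq_fun do rewrite -{1}[n0]add0n big_addn.
  apply: measurable_sum => j.
  have mj := @measurable_tail _ _ _ eta _ _ (leq_addl j n0).
  apply: measurable_funB; apply: measurable_funM => //.
  - exact: (measurableT_comp measurable_fst mj).
  - exact: (measurableT_comp measurable_snd mj).
pose B : set Omega := [set w |
  cvg_locally_uniformly h (combination (fun j => eta j w) S) (psi w) /\
  L2_integrable dV h (psi w)].
have B0 : P.-negligible B.
  apply: (gaussian_translates_null heta mr) => w [cw Lw].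
  exact: (L2_limit_data SH SO C_compact C_exhaust cw Lw).
apply: negligibleS (negligibleU B0 hpsi) => w /= /contrapT Lw.
have [cw|ncw] := pselect (cvg_locally_uniformly h
  (combination (fun j => eta j w) S) (psi w)); [by left|by right].
Qed.
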